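(* For each DPO grammar $HGr$ and each $c\in\mathbb{N}$ there is an $\mathrm{HL}$-grammar generating $L_c(HGr)$, the set of all $H\in L(HGr)$ having a derivation $S^\bullet\Rightarrow^\ast H$ with at most $c\cdot|E_H|$ steps.
   Context: A DPO grammar $HGr=\langle N,\Sigma,P,S^\bullet\rangle$ has rules $L\overset{\varphi_L}{\leftarrow}\mathrm{Dis}_k\overset{\varphi_R}{\rightarrow}R$ with zero-rank $L,R$ and discrete interface $\mathrm{Dis}_k=\langle[k],\emptyset,\emptyset,\emptyset,\Lambda\rangle$ (the hypergraph with $k$ nodes, no hyperedges, no external nodes), applied by the double pushout approach; $L(HGr)$ is the set of terminal hypergraphs derivable from $S^\bullet$; $|E_H|$ is the number of hyperedges of $H$. $\mathrm{HL}$ is the hypergraph Lambek calculus (types built from primitive types by $\div$ and $\times$). An $\mathrm{HL}$-grammar $\langle\Sigma,S,\triangleright\rangle$ assigns finitely many types to each label and generates those hypergraphs $G$ admitting a type relabeling $f_G$ with $lab_G(e)\triangleright f_G(e)$ and $\mathrm{HL}\vdash f_G(G)\to S$. *)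

(* Defs.v *)
From HB Require Import structures.
From mathcomp Require Import all_boot.
From Stdlib Require List.

Set Implicit Arguments.
Unset Strict Implicit.
Unset Printing Implicit Defensive.

(** * Ranked alphabets and hypergraphs *)

Record ranked := Ranked { letter :> finType; rk : letter -> nat }.

(* A ranked label set is handled as the family of its fibres: the set of
   labels of rank [k], for each [k].  For a finite ranked alphabet this is: *)
Definition fib (S : ranked) (k : nat) : Type := {a : S | rk a == k}.

Definition ranked_sum (N S : ranked) : ranked :=
  @Ranked (N + S)%type
    (fun x => match x with inl a => rk a | inr a => rk a end).

(* [hg L n]: hypergraphs of rank [n] over [L].  The attachment strings and the
   string of external nodes are arbitrary: repetitions are allowed.  The rank
   condition |att e| = rk (lab e) is enforced by typing. *)
Record hg (L : nat -> Type) (n : nat) := Hg {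
  hV : finType;
  hE : finType;
  har : hE -> nat;
  hatt : forall e : hE, (har e).-tuple hV;
  hlab : forall e : hE, L (har e);
  hext : n.-tuple hV }.

Arguments Hg {L n hV hE har} hatt hlab hext.
Arguments har {L n} _ _.
Arguments hatt {L n} _ _.
Arguments hlab {L n} _ _.
Arguments hext {L n} _.

(* The handle of a label. *)
Definition handle (L : nat -> Type) (k : nat) (a : L k) : hg L k :=
  @Hg L k 'I_k unit (fun _ => k) (fun _ => ord_tuple k) (fun _ => a)
    (ord_tuple k).

(* Relabelling; [f] may depend on the hyperedge, not only on its label. *)
Definition relabel (L L' : nat -> Type) (n : nat) (G : hg L n)
    (f : forall e : hE G, L' (har G e)) : hg L' n :=
  Hg (hatt G) f (hext G).

(** * Morphisms and isomorphisms *)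

(* Morphisms preserve attachments and labels (ranks included, whence the
   dependent pairs) and disregard external nodes. *)
Record morph (L : nat -> Type) (n m : nat) (G : hg L n) (H : hg L m) := Morph {
  mV : hV G -> hV H;
  mE : hE G -> hE H;
  morph_att : forall e, map mV (hatt G e) = hatt H (mE e) :> seq (hV H);
  morph_lab : forall e, Tagged L (hlab G e) = Tagged L (hlab H (mE e)) }.

Definition hiso (L : nat -> Type) (n : nat) (G H : hg L n) : Prop :=
  exists f : morph G H,
    [/\ bijective (mV f), bijective (mE f)
      & hext H = map (mV f) (hext G) :> seq (hV H)].

(** * Hyperedge replacement *)

(* The quotient of [T] by the equivalence generated by the pairs in [s]. *)
Section Fuse.
Variables (T : finType) (s : seq (T * T)).

Definition fuse_rel : rel T :=
  fun x y => ((x, y) \in s) || ((y, x) \in s).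

Lemma fuse_sym : connect_sym fuse_rel.
Proof. by apply: sym_connect_sym => x y; rewrite /fuse_rel orbC. Qed.

Definition fuse := {x : T | roots fuse_rel x}.

Definition fuse_pi (x : T) : fuse :=
  exist _ (root fuse_rel x) (roots_root fuse_sym x).
End Fuse.

(* [ctx L n m]: a hypergraph of rank [n] with exactly one hyperedge labelled by
   the special symbol $ of rank [m], all other hyperedges being labelled in
   [L].  The hyperedge $ is not listed in [cE]; [chole] is its attachment. *)
Record ctx (L : nat -> Type) (n m : nat) := Ctx {
  cV : finType;
  cE : finType;
  car : cE -> nat;
  catt : forall e : cE, (car e).-tuple cV;
  clab : forall e : cE, L (car e);
  cext : n.-tuple cV;
  chole : m.-tuple cV }.

Arguments Ctx {L n m cV cE car} catt clab cext chole.
Arguments car {L n m} _ _.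
Arguments catt {L n m} _ _.
Arguments clab {L n m} _ _.
Arguments cext {L n m} _.
Arguments chole {L n m} _.

(* [C[$ / F]]: the $-hyperedge is removed, a disjoint copy of [F] is added and
   the i-th external node of [F] is fused with the i-th attachment node of $.
   A hypergraph G with a chosen hyperedge e labelled [a] is
   [fill C (handle a)] up to isomorphism, for C obtained by relabelling e by $,
   and then G[e / F] is [fill C F]. *)
Section Fill.
Variables (L : nat -> Type) (n m : nat) (C : ctx L n m) (F : hg L m).

Definition fill_pairs : seq ((cV C + hV F) * (cV C + hV F)) :=
  [seq (inl p.1, inr p.2) | p <- zip (chole C) (hext F)].

Definition fill_pi : (cV C + hV F)%type -> fuse fill_pairs :=
  fuse_pi fill_pairs.

Definition fill_ar (u : (cE C + hE F)%type) : nat :=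
  match u with inl e => car C e | inr e => har F e end.

Definition fill_att (u : (cE C + hE F)%type) :
    (fill_ar u).-tuple (fuse fill_pairs) :=
  match u with
  | inl e => map_tuple (fun x => fill_pi (inl x)) (catt C e)
  | inr e => map_tuple (fun x => fill_pi (inr x)) (hatt F e)
  end.

Definition fill_lab (u : (cE C + hE F)%type) : L (fill_ar u) :=
  match u with inl e => clab C e | inr e => hlab F e end.

Definition fill : hg L n :=
  Hg fill_att fill_lab (map_tuple (fun x => fill_pi (inl x)) (cext C)).
End Fill.

(* [M[e / F e for every hyperedge e]]: simultaneous replacement of all
   hyperedges. *)
Section Subst.
Variables (L L' : nat -> Type) (n : nat) (M : hg L n).
Variable F : forall e : hE M, hg L' (har M e).

Definition subst_node : finType := (hV M + {e : hE M & hV (F e)})%type.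

Definition copy_node (e : hE M) (x : hV (F e)) : subst_node :=
  inr (Tagged (fun e => hV (F e)) x).

Definition subst_pairs : seq (subst_node * subst_node) :=
  flatten [seq [seq (inl p.1 : subst_node, copy_node p.2)
               | p <- zip (hatt M e) (hext (F e))]
          | e <- enum (hE M)].

Definition subst_pi : subst_node -> fuse subst_pairs := fuse_pi subst_pairs.

Definition subst_edge : finType := {e : hE M & hE (F e)}.

Definition subst : hg L' n :=
  @Hg L' n (fuse subst_pairs) subst_edge
    (fun u => har (F (tag u)) (tagged u))
    (fun u => map_tuple (fun x => subst_pi (copy_node x))
                (hatt (F (tag u)) (tagged u)))
    (fun u => hlab (F (tag u)) (tagged u))
    (map_tuple (fun x => subst_pi (inl x)) (hext M)).
End Subst.

(* Simultaneous replacement of all hyperedges except the $-labelled one. *)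
Definition ctx_rest (L : nat -> Type) (n m : nat) (D : ctx L n m) : hg L n :=
  Hg (catt D) (clab D) (cext D).

Definition ctx_subst (L L' : nat -> Type) (n m : nat) (D : ctx L n m)
    (F : forall e : cE D, hg L' (car D e)) : ctx L' n m :=
  let K := @subst L L' n (ctx_rest D) F in
  Ctx (hatt K) (hlab K) (hext K)
    (map_tuple (fun x => @subst_pi L L' n (ctx_rest D) F (inl x)) (chole D)).

(** * The hypergraph Lambek calculus *)

(* [Tp k]: the types of rank [k]; [Prim i] is the i-th primitive type of rank
   [k], [Div N D] is N ÷ D and [Times M] is ×(M). *)
Inductive Tp : nat -> Type :=
| Prim (k : nat) (i : nat) : Tp k
| Div (m k : nat) (N : Tp m) (D : ctx Tp m k) : Tp k
| Times (k : nat) (M : hg Tp k) : Tp k.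

(* [HL G A]: the sequent G -> A is derivable.  [HL_iso] reflects that
   hypergraphs are considered up to isomorphism. *)
Inductive HL : forall n : nat, hg Tp n -> Tp n -> Prop :=
| HL_iso (n : nat) (G H : hg Tp n) (A : Tp n) :
    hiso G H -> HL G A -> HL H A
| HL_ax (n : nat) (A : Tp n) : HL (handle A) A
| HL_div_left (n m k : nat) (C : ctx Tp n m) (N : Tp m) (D : ctx Tp m k)
    (A : Tp n) (F : forall e : cE D, hg Tp (car D e)) :
    HL (fill C (handle N)) A ->
    (forall e : cE D, HL (F e) (clab D e)) ->
    HL (fill C (fill (ctx_subst F) (handle (Div N D)))) A
| HL_div_right (m k : nat) (N : Tp m) (D : ctx Tp m k) (F : hg Tp k) :
    HL (fill D F) N -> HL F (Div N D)
| HL_times_left (n m : nat) (C : ctx Tp n m) (F : hg Tp m) (A : Tp n) :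
    HL (fill C F) A -> HL (fill C (handle (Times F))) A
| HL_times_right (n : nat) (M : hg Tp n) (F : forall e : hE M, hg Tp (har M e)) :
    (forall e : hE M, HL (F e) (hlab M e)) -> HL (subst F) (Times M).

(* HL-grammars over [S] whose distinguished type has rank [n].  A letter [a] is
   related by the relation |> to the finitely many types in [hl_assign a]. *)
Record hl_grammar (S : ranked) (n : nat) := HlGrammar {
  hl_assign : forall k : nat, fib S k -> seq (Tp k);
  hl_goal : Tp n }.

Definition hl_generates (S : ranked) (n : nat) (Gr : hl_grammar S n)
    (G : hg (fib S) n) : Prop :=
  exists f : forall e : hE G, Tp (har G e),
    (forall e, List.In (f e) (hl_assign Gr (hlab G e)))
    /\ HL (relabel f) (hl_goal Gr).

(** * Double pushout grammars *)

Definition is_pushout (L : nat -> Type) (a b c p : nat)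
    (A : hg L a) (B : hg L b) (C : hg L c) (P : hg L p)
    (f : morph A B) (g : morph A C) (i : morph B P) (j : morph C P) : Prop :=
  [/\ mV i \o mV f =1 mV j \o mV g,
      mE i \o mE f =1 mE j \o mE g
    & forall (x : nat) (X : hg L x) (u : morph B X) (v : morph C X),
        mV u \o mV f =1 mV v \o mV g ->
        mE u \o mE f =1 mE v \o mE g ->
        let mediates (h : morph P X) :=
          [/\ mV h \o mV i =1 mV u, mE h \o mE i =1 mE u,
              mV h \o mV j =1 mV v & mE h \o mE j =1 mE v] in
        (exists h : morph P X, mediates h) /\
        (forall h h' : morph P X, mediates h -> mediates h' ->
           mV h =1 mV h' /\ mE h =1 mE h')].

Definition Dis (L : nat -> Type) (k : nat) : hg L 0 :=
  @Hg L 0 'I_k void (fun e => match e with end) (fun e => match e with end)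
    (fun e => match e with end) [tuple].

(* Neither the morphisms of a rule nor the matches are required to be
   injective. *)
Record dpo_rule (L : nat -> Type) := DpoRule {
  interface : nat;
  lhs : hg L 0;
  rhs : hg L 0;
  phiL : morph (Dis L interface) lhs;
  phiR : morph (Dis L interface) rhs }.

(* The external nodes of the host hypergraph, if there are any, belong to the
   context [D] and are carried along; for [n = 0] the last two conditions are
   void and this is the usual double pushout. *)
Definition dpo_apply (L : nat -> Type) (r : dpo_rule L) (n : nat)
    (G H : hg L n) : Prop :=
  exists (D : hg L n) (d : morph (Dis L (interface r)) D)
         (mL : morph (lhs r) G) (g : morph D G)
         (mR : morph (rhs r) H) (h : morph D H),
    [/\ is_pushout (phiL r) d mL g,
        is_pushout (phiR r) d mR h,
        hext G = map (mV g) (hext D) :> seq (hV G)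
      & hext H = map (mV h) (hext D) :> seq (hV H)].

Record dpo_grammar (N S : ranked) := DpoGrammar {
  dpo_rules : seq (dpo_rule (fib (ranked_sum N S)));
  dpo_start : N }.

Section DpoLanguage.
Variables (N S : ranked) (HGr : dpo_grammar N S).

Definition dpo_step (n : nat) (G H : hg (fib (ranked_sum N S)) n) : Prop :=
  exists r, List.In r (dpo_rules HGr) /\ dpo_apply r G H.

(* A derivation of exactly [t] steps. *)
Fixpoint dpo_steps (t : nat) (n : nat) (G H : hg (fib (ranked_sum N S)) n) :
    Prop :=
  match t with
  | 0 => hiso G H
  | t'.+1 => exists G', dpo_step G G' /\ dpo_steps t' G' H
  end.

Definition start_rank : nat := rk (dpo_start HGr).

Definition start_hg : hg (fib (ranked_sum N S)) start_rank :=
  handle (exist (fun x : ranked_sum N S => rk x == start_rank)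
            (inl (dpo_start HGr)) (eqxx start_rank)).

Definition term_label (k : nat) (a : fib S k) : fib (ranked_sum N S) k :=
  exist (fun x : ranked_sum N S => rk x == k) (inr (sval a)) (svalP a).

Definition term_hg (n : nat) (H : hg (fib S) n) :
    hg (fib (ranked_sum N S)) n :=
  relabel (fun e : hE H => term_label (hlab H e)).

Definition dpo_derives (t : nat) (H : hg (fib S) start_rank) : Prop :=
  dpo_steps t start_hg (term_hg H).

Definition dpo_language (H : hg (fib S) start_rank) : Prop :=
  exists t, dpo_derives t H.

(* L_c(HGr) *)
Definition dpo_language_bounded (c : nat) (H : hg (fib S) start_rank) : Prop :=
  dpo_language H /\ exists2 t, t <= c * #|hE H| & dpo_derives t H.
End DpoLanguage.

Arguments dpo_derives {N S} HGr t H.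
Arguments dpo_language {N S} HGr H.
Arguments dpo_language_bounded {N S} HGr c H.

(* Main.v *)
(** Reverse rule application is a rank-0 type: if a rule has left-hand side [l]
    and right-hand side [r], seen as hypergraphs whose external nodes are the
    images of the interface, then the left rules for [T := ×(l) ÷ r]
    turn, read from conclusion to premise, a copy of [r] together with a
    floating [T]-hyperedge into [l].  A letter [a] is assigned the types
    [×(a + T_1 + ... + T_m)], [m <= c], so a terminal hypergraph with [E]
    hyperedges has at most [c * E] rule applications at its disposal.

    For the converse, types are interpreted by sets of hypergraphs decorated
    with one rank-0 "tick" per rule application and closed under derivation:
    [Prim x] by what is derivable from the handle of [x], [×(M)] by the closure
    of the instances of [M], and [N ÷ D] by the [Z] all of whose placements in
    an instance of [D] lie in [N].  All rules of HL are sound for this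
    interpretation, and the tick of a rule belongs to its type [T].

    Hyperedge replacement is handled through its universal property, for
    hypergraphs without rank discipline: iterated replacements are iterated
    colimits of sets, and both ways of computing them agree. *)
Require Import Defs.
From mathcomp Require Import all_boot.
From Stdlib Require Import FunctionalExtensionality.

Set Implicit Arguments.
Unset Strict Implicit.
Unset Printing Implicit Defensive.

(** The obstacle in the converse is that an HL-derivation need not follow any grammar derivation:
    its rules may act on × and ÷ in any order and at any place. Instead of normalising such
    derivations, the proof evaluates them in a model, so that each rule of HL is checked once.
    Closure under derivation is what lets a rule type hold of its own tick: an instance of the
    right-hand side together with the tick is derivable from the left-hand side. The tick also
    yields the bound. No left-hand side contains ticks, so they are never consumed and their number
    is the number of steps. A tick has rank 0, so it is attached to nothing, and removing all ticks
    from a decorated derivation leaves a derivation of the grammar. Rules and matches may be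
    non-injective, so a pushout complement need not be determined by a match. A step is therefore
    always described by the existence of one context that both sides of the rule fill; this form is
    stable under composition with further contexts. *)

(* [X] is the colimit of [A] and the [B i] along the [R i].  Nodes and
   hyperedges of a replacement are both of this form. *)
Definition set_colim (A X I : Type) (B : I -> Type) (R : forall i, A -> B i -> Prop)
    (a : A -> X) (b : forall i, B i -> X) : Prop :=
  [/\ forall i x y, R i x y -> a x = b i y,
      forall z, (exists x, a x = z) \/ (exists i y, b i y = z)
    & forall (T : Type) (f : A -> T) (h : forall i, B i -> T),
        (forall i x y, R i x y -> f x = h i y) ->
        exists u : X -> T,
          (forall x, u (a x) = f x) /\ (forall i y, u (b i y) = h i y)].

(** With the empty relation nothing is identified and the colimit is a disjoint union. The
    hyperedges of a replacement, and the index sets of iterated replacements, are of this kind. *)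
Definition norel (I A : Type) (B : I -> Type) (i : I) (x : A) (y : B i) : Prop :=
  False.

(** Joint surjectivity of the cocone stands in for uniqueness of mediating maps: the two maps given
    by the universal properties are inverse to each other on every element of the cocone, hence
    everywhere. *)
Lemma set_colim_unique A X X' I (B : I -> Type) (R : forall i, A -> B i -> Prop)
    a (b : forall i, B i -> X) a' (b' : forall i, B i -> X') :
  set_colim R a b -> set_colim R a' b' ->
  exists (u : X -> X') (v : X' -> X),
    [/\ cancel u v, cancel v u, forall x, u (a x) = a' x
      & forall i y, u (b i y) = b' i y].
Proof.
case=> E S U [E' S' U'].
have [u [ua ub]] := U _ a' b' E'.
have [v [va vb]] := U' _ a b E.
exists u, v; split=> // z.
  by case: (S z) => [[x <-]|[i [y <-]]]; rewrite ?ua ?va ?ub ?vb.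
by case: (S' z) => [[x <-]|[i [y <-]]]; rewrite ?va ?ua ?vb ?ub.
Qed.

(** Defines a dependent family by cases on the component an element comes from. The universal
    property is applied to the sigma type of [P], and the value is transported back along the
    equality of first components; decidable equality on [X] makes that transport trivial on the
    components. *)
Lemma set_colim_dep A (X : eqType) I (B : I -> Type) (a : A -> X)
    (b : forall i, B i -> X) (P : X -> Type)
    (f : forall x, P (a x)) (h : forall i y, P (b i y)) :
  set_colim (@norel I A B) a b ->
  exists g : forall z, P z,
    (forall x, g (a x) = f x) /\ (forall i y, g (b i y) = h i y).
Proof.
case=> _ S U.
have [|u [ua ub]] := U _ (fun x => existT P _ (f x))
  (fun i y => existT P _ (h i y)); first by move=> i x y [].
have tu z : tag (u z) = z.
  by case: (S z) => [[x <-]|[i [y <-]]]; rewrite ?ua ?ub.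
exists (fun z => eq_rect _ P (tagged (u z)) _ (tu z)).
split=> [x|i y].
  by move: (tu (a x)); rewrite ua /= => q; rewrite (eq_axiomK q).
by move: (tu (b i y)); rewrite ub /= => q; rewrite (eq_axiomK q).
Qed.

Lemma set_colim_ind A X I (B : I -> Type) (R : forall i, A -> B i -> Prop)
    (a : A -> X) (b : forall i, B i -> X) (P : X -> Prop) :
  set_colim R a b -> (forall x, P (a x)) -> (forall i y, P (b i y)) ->
  forall z, P z.
Proof.
by move=> [_ S _] Pa Pb z; case: (S z) => [[x <-]|[i [y <-]]].
Qed.

Lemma set_colim_bij (A X : Type) (phi : A -> X) (psi : X -> A) (B : void -> Type)
    (R : forall i, A -> B i -> Prop) (b : forall i : void, B i -> X) :
  cancel phi psi -> cancel psi phi -> set_colim R phi b.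
Proof.
move=> c1 c2; split=> [[]|z|T f h _].
  by left; exists (psi z).
by exists (f \o psi); split=> [x|[]] /=; rewrite c1.
Qed.

Lemma set_colim_transport A A' X X' I (B B' : I -> Type)
    (R : forall i, A -> B i -> Prop) (R' : forall i, A' -> B' i -> Prop)
    (a : A -> X) (b : forall i, B i -> X)
    (fA : A -> A') (gA : A' -> A) (fB : forall i, B i -> B' i)
    (gB : forall i, B' i -> B i) (fX : X -> X') (gX : X' -> X) :
  cancel fA gA -> cancel gA fA ->
  (forall i, cancel (fB i) (gB i)) -> (forall i, cancel (gB i) (fB i)) ->
  cancel fX gX -> cancel gX fX ->
  (forall i x y, R' i (fA x) (fB i y) <-> R i x y) ->
  set_colim R a b ->
  set_colim R' (fun x => fX (a (gA x))) (fun i y => fX (b i (gB i y))).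
Proof.
move=> fAK gAK fBK gBK fXK gXK RR' [E S U]; split=> [i x y Rxy|z|T f h fh].
- by congr fX; apply/E/RR'; rewrite gAK gBK.
- case: (S (gX z)) => [[x xz]|[i [y yz]]].
    by left; exists (fA x); rewrite fAK xz gXK.
  by right; exists i, (fB i y); rewrite fBK yz gXK.
have [|u [ua ub]] := U T (fun x => f (fA x)) (fun i y => h i (fB i y)).
  by move=> i x y /RR'; apply: fh.
by exists (u \o gX); split=> [x|i y] /=; rewrite fXK ?ua ?ub ?gAK ?gBK.
Qed.

(** * Iterated colimits of sets *)

Section Assoc.
Variables (A0 : Type) (I : finType) (A_ : I -> Type).
Variable R : forall i, A0 -> A_ i -> Prop.
Variables (G : Type) (p : A0 -> G) (p_ : forall i, A_ i -> G).
Hypothesis colG : set_colim R p p_.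
Variables (J0 : Type) (J_ : I -> Type) (J : eqType).
Variables (q0 : J0 -> J) (q_ : forall i, J_ i -> J).
Hypothesis colJ : set_colim (@norel I J0 J_) q0 q_.
Variable H : J -> Type.
Variable S : forall j, G -> H j -> Prop.
Variable S0 : forall j : J0, A0 -> H (q0 j) -> Prop.
Variable S_ : forall i (j : J_ i), A_ i -> H (q_ j) -> Prop.
Arguments S_ {i} j.
Hypothesis S0P : forall j g h, S g h <-> exists2 x, g = p x & S0 (j := j) x h.
Hypothesis S_P :
  forall i (j : J_ i) g h, S g h <-> exists2 x, g = p_ x & S_ j x h.
Variables (Y0 : Type) (y0 : A0 -> Y0) (h0 : forall j, H (q0 j) -> Y0).
Hypothesis colY0 : set_colim S0 y0 h0.
Variables (Y_ : I -> Type) (y_ : forall i, A_ i -> Y_ i).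
Variable h_ : forall i (j : J_ i), H (q_ j) -> Y_ i.
Arguments h_ {i} j.
Hypothesis colY_ : forall i, set_colim (@S_ i) (@y_ i) (@h_ i).
Variable R' : forall i, Y0 -> Y_ i -> Prop.
Hypothesis R'P : forall i u v,
  R' (i := i) u v <-> exists x z, [/\ u = y0 x, v = y_ z & R x z].
Variable X : Type.

Definition assoc_eqs (g : G -> X) (xh : forall j, H j -> X) (k0 : Y0 -> X)
    (k_ : forall i, Y_ i -> X) : Prop :=
  [/\ forall x, k0 (y0 x) = g (p x),
      forall j h, k0 (h0 (j := j) h) = xh (q0 j) h,
      forall i x, k_ i (y_ x) = g (p_ (i := i) x)
    & forall i j h, k_ i (h_ j h) = xh (q_ j) h].

(** [G] is glued from [A0] and the [A_ i], and pieces [H j] are then glued onto [G]. Each piece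
    meets only one part: [A0] if [j] comes from [J0], and [A_ i] if it comes from [J_ i]. Gluing the
    pieces onto their own parts beforehand gives [Y0] and the [Y_ i], and gluing these along [R']
    gives the same [X]. This direction starts from the pieces glued onto [G]. *)
Lemma set_colim_assoc1 (g : G -> X) (xh : forall j, H j -> X) :
  set_colim S g xh ->
  exists k0 k_, set_colim R' k0 k_ /\ assoc_eqs g xh k0 k_.
Proof.
case: colG => EG SG UG; case: colY0 => E0 SY0 U0 [EX SX UX].
have [k0 [k0y k0h]] : exists u : Y0 -> X, (forall x, u (y0 x) = g (p x)) /\
    (forall j h, u (h0 (j := j) h) = xh (q0 j) h).
  by apply: U0 => j x h Sxh; apply: EX; apply/S0P; exists x.
(* Finiteness of [I] allows one mediating map per component to be chosen without a choice axiom. *)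
have /fin_all_exists[k_ k_P] : forall i, exists u : Y_ i -> X,
    (forall x, u (y_ x) = g (p_ x)) /\ (forall j h, u (h_ j h) = xh (q_ j) h).
  move=> i; case: (colY_ i) => _ _ Ui.
  by apply: Ui => j x h Sxh; apply: EX; apply/S_P; exists x.
have k_y i x : k_ i (y_ x) = g (p_ x) by case: (k_P i).
have k_h i j h : k_ i (h_ j h) = xh (q_ j) h by case: (k_P i).
exists k0, k_; split; last by split.
split=> [i u v /R'P[x [z [-> -> Rxz]]]|z|T f h fh].
- by rewrite k0y k_y (EG _ _ _ Rxz).
- case: (SX z) => [[w <-]|[j [w <-]]].
    case: (SG w) => [[x <-]|[i [x <-]]]; first by left; exists (y0 x).
    by right; exists i, (y_ x).
  move: j w; apply: (set_colim_ind colJ) => [j w|i j w].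
    by left; exists (h0 w).
  by right; exists i, (h_ j w).
have [|fG [fGp fGp_]] := UG T (f \o y0) (fun i => h i \o y_ (i := i)).
  by move=> i x y Rxy; apply: fh; apply/R'P; exists x, y.
have [fH [fH0 fH_]] := set_colim_dep (P := fun j => H j -> T)
  (fun j => f \o h0 (j := j)) (fun i j => h i \o h_ j) colJ.
have [|u [ug uh]] := UX T fG fH.
  apply: (set_colim_ind colJ) => [j|i j] x y.
    by move=> /S0P[x' -> Sx]; rewrite fGp fH0; congr (f _); apply: E0.
  case: (colY_ i) => Ei _ _ /S_P[x' -> Sx].
  by rewrite fGp_ fH_; congr (h i _); apply: Ei.
exists u; split=> [y|i y].
  by case: (SY0 y) => [[x <-]|[j [w <-]]]; rewrite ?k0y ?k0h ?ug ?uh ?fGp ?fH0.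
case: (colY_ i) => _ Si _.
by case: (Si y) => [[x <-]|[j [w <-]]]; rewrite ?k_y ?k_h ?ug ?uh ?fGp_ ?fH_.
Qed.

Lemma set_colim_assoc2 (k0 : Y0 -> X) (k_ : forall i, Y_ i -> X) :
  set_colim R' k0 k_ ->
  exists g xh, set_colim S g xh /\ assoc_eqs g xh k0 k_.
Proof.
case: colG => EG SG UG; case: colY0 => E0 SY0 U0 [EX SX UX].
have [|g [gp gp_]] := UG X (k0 \o y0) (fun i => k_ i \o y_ (i := i)).
  by move=> i x y Rxy; apply: EX; apply/R'P; exists x, y.
have [xh [xh0 xh_]] := set_colim_dep (P := fun j => H j -> X)
  (fun j => k0 \o h0 (j := j)) (fun i j => k_ i \o h_ j) colJ.
exists g, xh; split; last by split=> *; rewrite ?gp ?gp_ ?xh0 ?xh_.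
split=> [|z|T f h fh].
- apply: (set_colim_ind colJ) => [j|i j] x y.
    by move=> /S0P[x' -> Sx]; rewrite gp xh0; congr (k0 _); apply: E0.
  case: (colY_ i) => Ei _ _ /S_P[x' -> Sx].
  by rewrite gp_ xh_; congr (k_ i _); apply: Ei.
- case: (SX z) => [[w <-]|[i [w <-]]].
    case: (SY0 w) => [[x <-]|[j [x <-]]]; first by left; exists (p x); rewrite gp.
    by right; exists (q0 j), x; rewrite xh0.
  case: (colY_ i) => _ Si _.
  case: (Si w) => [[x <-]|[j [x <-]]]; first by left; exists (p_ x); rewrite gp_.
  by right; exists (q_ j), x; rewrite xh_.
have [|f0 [f0y f0h]] := U0 T (f \o p) (fun j => h (q0 j)).
  by move=> j x y Sx; apply: fh; apply/S0P; exists x.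
have /fin_all_exists[f_ f_P] : forall i, exists u : Y_ i -> T,
    (forall x, u (y_ x) = f (p_ x)) /\ (forall j w, u (h_ j w) = h (q_ j) w).
  move=> i; case: (colY_ i) => _ _ Ui.
  by apply: Ui => j x w Sxh; apply: fh; apply/S_P; exists x.
have f_y i x : f_ i (y_ x) = f (p_ x) by case: (f_P i).
have f_h i j w : f_ i (h_ j w) = h (q_ j) w by case: (f_P i).
have [|u [u0 u_]] := UX T f0 f_.
  by move=> i v w /R'P[x [y [-> -> Rxy]]]; rewrite f0y f_y; congr (f _); apply: EG.
exists u; split=> [w|j w].
  by case: (SG w) => [[x <-]|[i [x <-]]]; rewrite ?gp ?gp_ /= ?u0 ?u_.
move: j w; apply: (set_colim_ind colJ) => [j|i j] w.
  by rewrite xh0 /= u0 f0h.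
by rewrite xh_ /= u_ f_h.
Qed.
End Assoc.

(** * Untyped hypergraphs and contexts *)

(* Ranks are not enforced.  Contexts are hypergraphs whose string [rhole] is
   the attachment of $; for plain hypergraphs [rhole] is empty. *)
Record raw (L : Type) := Raw {
  rV : finType;
  rE : finType;
  ratt : rE -> seq rV;
  rlab : rE -> L;
  rext : seq rV;
  rhole : seq rV }.

Record isom (L : Type) (X Y : raw L) := Isom {
  iV : rV X -> rV Y;
  iV' : rV Y -> rV X;
  iE : rE X -> rE Y;
  iE' : rE Y -> rE X;
  iVK : cancel iV iV';
  iVK' : cancel iV' iV;
  iEK : cancel iE iE';
  iEK' : cancel iE' iE;
  iso_att : forall e, ratt (iE e) = map iV (ratt e);
  iso_lab : forall e, rlab (iE e) = rlab e;
  iso_ext : rext Y = map iV (rext X);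
  iso_hole : rhole Y = map iV (rhole X) }.

Definition riso (L : Type) (X Y : raw L) : Prop := exists m : isom X Y, True.

Lemma map_cancel (T U : Type) (f : T -> U) (g : U -> T) (s : seq T) :
  cancel f g -> map g (map f s) = s.
Proof. by move=> fK; rewrite -map_comp (eq_map (g := id)) ?map_id. Qed.

Definition isom_refl (L : Type) (X : raw L) : isom X X.
Proof. by apply: (@Isom _ X X id id id id) => // *; rewrite map_id. Defined.

Definition isom_sym (L : Type) (X Y : raw L) (m : isom X Y) : isom Y X.
Proof.
apply: (@Isom _ Y X (iV' m) (iV m) (iE' m) (iE m));
  try by [apply: iVK | apply: iVK' | apply: iEK | apply: iEK'].
- by move=> e; rewrite -{2}(iEK' m e) iso_att (map_cancel _ (iVK m)).
- by move=> e; rewrite -{2}(iEK' m e) iso_lab.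
- by rewrite (iso_ext m) (map_cancel _ (iVK m)).
- by rewrite (iso_hole m) (map_cancel _ (iVK m)).
Defined.

Definition isom_trans (L : Type) (X Y Z : raw L) (m : isom X Y)
  (n : isom Y Z) : isom X Z.
Proof.
apply: (@Isom _ X Z (iV n \o iV m) (iV' m \o iV' n) (iE n \o iE m)
   (iE' m \o iE' n)).
- exact: can_comp (iVK n) (iVK m).
- exact: can_comp (iVK' m) (iVK' n).
- exact: can_comp (iEK n) (iEK m).
- exact: can_comp (iEK' m) (iEK' n).
- by move=> e; rewrite /= !iso_att -map_comp.
- by move=> e; rewrite /= !iso_lab.
- by rewrite (iso_ext n) (iso_ext m) -map_comp.
- by rewrite (iso_hole n) (iso_hole m) -map_comp.
Defined.

Lemma riso_refl (L : Type) (X : raw L) : riso X X.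
Proof. by exists (isom_refl X). Qed.

Lemma riso_sym (L : Type) (X Y : raw L) : riso X Y -> riso Y X.
Proof. by case=> m _; exists (isom_sym m). Qed.

Lemma riso_trans (L : Type) (X Y Z : raw L) : riso X Y -> riso Y Z -> riso X Z.
Proof. by case=> m _ [n _]; exists (isom_trans m n). Qed.

(** * Gluing *)

(** Entries at equal positions are to be fused. Repeated entries are allowed, so a gluing may also
    identify nodes within one component. *)
Definition zrel (T U : eqType) (s : seq T) (t : seq U) (x : T) (y : U) : Prop :=
  (x, y) \in zip s t.

Lemma zrel_map (T U T' U' : eqType) (f : T -> T') (g : U -> U') s t x y :
  zrel (map f s) (map g t) x y <->
  exists x' y', [/\ x = f x', y = g y' & zrel s t x' y'].
Proof.
rewrite /zrel; elim: s t => [|a s IH] [|b t] /=;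
  try by split=> // [[x' [y' []]]].
rewrite in_cons; split=> [/orP[/eqP[-> ->]|st]|].
- by exists a, b; rewrite in_cons eqxx.
- have [x' [y' [-> -> st']]] := (IH t).1 st.
  by exists x', y'; rewrite in_cons st' orbT.
case=> x' [y' [ex ey]]; rewrite !in_cons => /orP[/eqP[xa yb]|st].
  by rewrite ex ey xa yb eqxx.
by apply/orP; right; apply: (IH t).2; exists x', y'.
Qed.

Record gmap (L : Type) (B : raw L) (I : Type) (F : I -> raw L) (X : raw L) :=
  Gmap {
    gB : rV B -> rV X;
    gF : forall i, rV (F i) -> rV X;
    gBE : rE B -> rE X;
    gFE : forall i, rE (F i) -> rE X }.

(* [X] is obtained from the disjoint union of [B] and of all [F i] by fusing
   the string [al i] of nodes of [B] with the external nodes of [F i]. *)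
Record gluing (L : Type) (B : raw L) (I : Type) (al : I -> seq (rV B))
    (F : I -> raw L) (X : raw L) (m : gmap B F X) : Prop := Gl {
  gl_V : set_colim (fun i => @zrel (rV B) (rV (F i)) (al i) (rext (F i)))
           (gB m) (@gF _ _ _ _ _ m);
  gl_E : set_colim (@norel I (rE B) (fun i => rE (F i))) (gBE m) (@gFE _ _ _ _ _ m);
  gl_attB : forall e, ratt (gBE m e) = map (gB m) (ratt e);
  gl_labB : forall e, rlab (gBE m e) = rlab e;
  gl_attF : forall i e, ratt (gFE m (i := i) e) = map (@gF _ _ _ _ _ m i) (ratt e);
  gl_labF : forall i e, rlab (gFE m (i := i) e) = rlab e;
  gl_ext : rext X = map (gB m) (rext B) }.

Definition set_hole (L : Type) (X : raw L) (s : seq (rV X)) : raw L :=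
  Raw (@ratt L X) (@rlab L X) (rext X) s.

Lemma fuse_compat (T : finType) (U : Type) (s : seq (T * T)) (f : T -> U) :
  (forall p, p \in s -> f p.1 = f p.2) ->
  forall x y, connect (fuse_rel s) x y -> f x = f y.
Proof.
move=> fs x _ /connectP[q qP ->]; elim: q x qP => //= y q IH x /andP[xy /IH <-].
by case/orP: xy => [/fs|/fs/esym].
Qed.

Lemma fuse_univ (T : finType) (U : Type) (s : seq (T * T)) (f : T -> U) :
  (forall p, p \in s -> f p.1 = f p.2) ->
  forall x, f (val (fuse_pi s x)) = f x.
Proof.
move=> fs x; apply/esym/(fuse_compat fs); exact: connect_root.
Qed.

Lemma fuse_piP (T : finType) (s : seq (T * T)) x y :
  (x, y) \in s -> fuse_pi s x = fuse_pi s y.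
Proof.
move=> xy; apply/val_inj/eqP=> /=; rewrite root_connect; last exact: fuse_sym.
by apply: connect1; rewrite /fuse_rel xy.
Qed.

Lemma fuse_pi_val (T : finType) (s : seq (T * T)) (z : fuse s) :
  fuse_pi s (val z) = z.
Proof. by apply/val_inj/eqP; apply: (valP z). Qed.

Lemma gl_ex (L : Type) (B : raw L) (I : finType) (al : I -> seq (rV B))
    (F : I -> raw L) : exists X (m : gmap B F X), gluing al m.
Proof.
pose T : finType := (rV B + {i : I & rV (F i)})%type.
pose cp i (y : rV (F i)) : T := inr (Tagged (fun i => rV (F i)) y).
pose s : seq (T * T) := flatten [seq [seq (inl p.1, cp i p.2)
  | p <- zip (al i) (rext (F i))] | i <- enum I].
pose u : rV B -> fuse s := fun x => fuse_pi s (inl x).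
pose v i : rV (F i) -> fuse s := fun y => fuse_pi s (cp i y).
pose E : finType := (rE B + {i : I & rE (F i)})%type.
pose att (e : E) : seq (fuse s) := match e with inl e => map u (ratt e)
  | inr e => map (@v (tag e)) (ratt (tagged e)) end.
pose lab (e : E) := match e with inl e => rlab e | inr e => rlab (tagged e) end.
pose X := Raw att lab (map u (rext B)) [::].
exists X, (@Gmap L B I F X u v (fun e => inl e)
  (fun i e => inr (Tagged (fun i => rE (F i)) e))).
split=> //=; split=> [i x y xy|z|U f h fh].
- apply: fuse_piP; apply/flattenP; exists [seq (inl p.1, cp i p.2)
    | p <- zip (al i) (rext (F i))].
    by apply/mapP; exists i; rewrite ?mem_enum.
  by apply/mapP; exists (x, y).
- case E1: (val z) => [x|[i y]]; [left; exists x | right; exists i, y];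
    by rewrite -[z]fuse_pi_val E1.
- pose w (t : T) := match t with inl x => f x | inr y => h _ (tagged y) end.
  have ws p : p \in s -> w p.1 = w p.2.
    case/flattenP=> _ /mapP[i _ ->] /mapP[[x y] xy ->] /=; exact: fh.
  exists (w \o val); split=> [x|i y]; exact: (fuse_univ ws).
- by [].
- by case: z => [x|[i y]]; [left; exists x | right; exists i, y].
- exists (fun e => match e with inl x => f x | inr y => h _ (tagged y) end).
  by [].
Qed.

(** A gluing says nothing about [rhole], which is chosen afterwards. The three cases are: no hole, a
    hole inherited from the base (replacement inside a context), and a hole inherited from a
    component (composition of contexts). *)
Lemma gl_uniq (L : Type) (B : raw L) (I : Type) (al : I -> seq (rV B))
    (F : I -> raw L) X X' (m : gmap B F X) (m' : gmap B F X') :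
  gluing al m -> gluing al m' ->
  forall s s', s' = [::] /\ s = [::]
    \/ (exists t, s = map (gB m) t /\ s' = map (gB m') t)
    \/ (exists i t, s = map (@gF _ _ _ _ _ m i) t /\ s' = map (@gF _ _ _ _ _ m' i) t) ->
  riso (set_hole s) (set_hole s').
Proof.
move=> g g' s s' hs.
have [u [v [uK vK uB uF]]] := set_colim_unique (gl_V g) (gl_V g').
have [k [l [kK lK kB kF]]] := set_colim_unique (gl_E g) (gl_E g').
have mB t : map (gB m') t = map u (map (gB m) t).
  by rewrite -map_comp; apply: eq_map => x /=; rewrite uB.
have mF i t : map (@gF _ _ _ _ _ m' i) t = map u (map (@gF _ _ _ _ _ m i) t).
  by rewrite -map_comp; apply: eq_map => x /=; rewrite uF.
unshelve eexists (@Isom L (set_hole s) (set_hole s') u v k l uK vK kK lK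
  _ _ _ _) => //=.
- apply: (set_colim_ind (gl_E g)) => [e|i e].
    by rewrite kB (gl_attB g) (gl_attB g').
  by rewrite kF (gl_attF g) (gl_attF g').
- apply: (set_colim_ind (gl_E g)) => [e|i e].
    by rewrite kB (gl_labB g) (gl_labB g').
  by rewrite kF (gl_labF g) (gl_labF g').
- by rewrite (gl_ext g) (gl_ext g').
- by case: hs => [[-> ->]|[[t [-> ->]]|[i [t [-> ->]]]]].
Qed.

Lemma gl_transport (L : Type) (B B' : raw L) (I : Type) (al : I -> seq (rV B))
    (F F' : I -> raw L) X X' (m : gmap B F X)
    (jB : isom B B') (jF : forall i, isom (F i) (F' i)) (jX : isom X X') :
  gluing al m -> exists m' : gmap B' F' X',
    [/\ gluing (fun i => map (iV jB) (al i)) m',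
        forall x, gB m' (iV jB x) = iV jX (gB m x)
      & forall i y, gF m' (iV (jF i) y) = iV jX (gF m (i := i) y)].
Proof.
move=> g.
pose m' := @Gmap L B' I F' X' (fun x => iV jX (gB m (iV' jB x)))
  (fun i y => iV jX (gF m (iV' (jF i) y)))
  (fun x => iE jX (gBE m (iE' jB x)))
  (fun i y => iE jX (gFE m (iE' (jF i) y))).
have eB x : gB m' (iV jB x) = iV jX (gB m x) by rewrite /= iVK.
have eF i y : gF m' (iV (jF i) y) = iV jX (gF m (i := i) y) by rewrite /= iVK.
have mB t : map (gB m') t = map (iV jX) (map (gB m) (map (iV' jB) t)).
  by rewrite -!map_comp; apply: eq_map => x /=.
have mF i t : map (@gF _ _ _ _ _ m' i) t =
    map (iV jX) (map (@gF _ _ _ _ _ m i) (map (iV' (jF i)) t)).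
  by rewrite -!map_comp; apply: eq_map => x /=.
exists m'; split=> //; split.
- apply: (set_colim_transport (iVK jB) (iVK' jB) (fun i => iVK (jF i))
    (fun i => iVK' (jF i)) (iVK jX) (iVK' jX) _ (gl_V g)) => i x y.
  rewrite (iso_ext (jF i)) zrel_map; split=> [[x' [y' []]]|xy].
    by move=> /(can_inj (iVK _)) -> /(can_inj (iVK _)) ->.
  by exists x, y.
- exact: (set_colim_transport (iEK jB) (iEK' jB) (fun i => iEK (jF i))
    (fun i => iEK' (jF i)) (iEK jX) (iEK' jX) _ (gl_E g)).
- by move=> e; rewrite mB iso_att (gl_attB g) (iso_att (isom_sym jB)).
- by move=> e; rewrite iso_lab (gl_labB g) (iso_lab (isom_sym jB)).
- by move=> i e; rewrite mF iso_att (gl_attF g) (iso_att (isom_sym (jF i))).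
- by move=> i e; rewrite iso_lab (gl_labF g) (iso_lab (isom_sym (jF i))).
- by rewrite mB (iso_ext jX) (gl_ext g) (iso_ext (isom_sym jB)).
Qed.

Section GlAssoc.
Variables (L : Type) (B0 : raw L) (I : finType) (al : I -> seq (rV B0)).
Variables (B_ : I -> raw L) (G : raw L) (p : gmap B0 B_ G).
Hypothesis glG : gluing al p.
Variables (J0 : Type) (J_ : I -> Type) (J : eqType).
Variables (q0 : J0 -> J) (q_ : forall i, J_ i -> J).
Hypothesis colJ : set_colim (@norel I J0 J_) q0 q_.
Variable H : J -> raw L.
Variable be : J -> seq (rV G).
Variable be0 : J0 -> seq (rV B0).
Variable be_ : forall i, J_ i -> seq (rV (B_ i)).
Hypothesis be0P : forall j, be (q0 j) = map (gB p) (be0 j).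
Hypothesis be_P : forall i (j : J_ i), be (q_ j) = map (@gF _ _ _ _ _ p i) (be_ j).
Variables (Y0 : raw L) (y0 : gmap B0 (H \o q0) Y0).
Hypothesis glY0 : gluing be0 y0.
Variables (Y_ : I -> raw L) (y_ : forall i, gmap (B_ i) (H \o q_ (i := i)) (Y_ i)).
Hypothesis glY_ : forall i, gluing (be_ (i := i)) (y_ i).
Variable X : raw L.

Definition gl_eqs (g : gmap G H X) (k : gmap Y0 Y_ X) : Prop :=
  [/\ forall x, gB k (gB y0 x) = gB g (gB p x),
      forall i x, gF k (gB (y_ i) x) = gB g (gF p (i := i) x)
    & forall i (j : J_ i) x, gF k (gF (y_ i) (i := j) x) = gF g (i := q_ j) x].

Let al' i := map (gB y0) (al i).

Let S0P j (g : rV G) (h : rV (H (q0 j))) :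
  zrel (be (q0 j)) (rext (H (q0 j))) g h <->
  exists2 x, g = gB p x & zrel (be0 j) (rext (H (q0 j))) x h.
Proof.
rewrite be0P -[rext _]map_id zrel_map map_id.
by split=> [[x [_ [-> <- xh]]]|[x -> xh]]; exists x => //; exists h.
Qed.

Let S_P i (j : J_ i) (g : rV G) (h : rV (H (q_ j))) :
  zrel (be (q_ j)) (rext (H (q_ j))) g h <->
  exists2 x, g = gF p x & zrel (be_ j) (rext (H (q_ j))) x h.
Proof.
rewrite be_P -[rext _]map_id zrel_map map_id.
by split=> [[x [_ [-> <- xh]]]|[x -> xh]]; exists x => //; exists h.
Qed.

Let R'P i (u : rV Y0) (v : rV (Y_ i)) :
  zrel (al' i) (rext (Y_ i)) u v <->
  exists x z, [/\ u = gB y0 x, v = gB (y_ i) z & zrel (al i) (rext (B_ i)) x z].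
Proof. by rewrite (gl_ext (glY_ i)) /al' zrel_map. Qed.

Let E0 (A C A' : Type) (f : A -> A') (x : A') (y : C) : False <->
  exists2 x' : A, x = f x' & False.
Proof. by split=> // [[]]. Qed.

Let E1 (A C A' C' : Type) (f : A -> A') (f' : C -> C') (x : A') (y : C') :
  False <-> exists (x' : A) (y' : C), [/\ x = f x', y = f' y' & False].
Proof. by split=> // [[x' [y' []]]]. Qed.

(** Nodes and hyperedges are two separate instances of associativity for sets, with the relations
    [zrel] for nodes and empty relations for hyperedges. Attachments and labels are then compared on
    each component. *)
Lemma gl_assoc1 (g : gmap G H X) :
  gluing be g -> exists k : gmap Y0 Y_ X, gluing al' k /\ gl_eqs g k.
Proof.
move=> glg.
have [k0 [k_ [kc [k1 k2 k3 k4]]]] := set_colim_assoc1 (gl_V glG) colJ S0P S_P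
  (gl_V glY0) (fun i => gl_V (glY_ i)) R'P (gl_V glg).
have [l0 [l_ [lc [l1 l2 l3 l4]]]] := set_colim_assoc1 (gl_E glG) colJ
  (S := @norel J (rE G) (fun j => rE (H j)))
  (fun j g h => E0 (gBE p) g h) (fun i j g h => E0 (gFE p (i := i)) g h)
  (gl_E glY0) (fun i => gl_E (glY_ i))
  (R' := @norel I (rE Y0) (fun i => rE (Y_ i)))
  (fun i u v => E1 _ _ _ _) (gl_E glg).
exists (Gmap k0 k_ l0 l_); split; last by split.
split=> //=.
- apply: (set_colim_ind (gl_E glY0)) => [e|j e].
    rewrite l1 (gl_attB glg) (gl_attB glG) (gl_attB glY0) -!map_comp.
    by apply: eq_map => x /=; rewrite k1.
  rewrite l2 (gl_attF glg) (gl_attF glY0) -!map_comp.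
  by apply: eq_map => x /=; rewrite k2.
- apply: (set_colim_ind (gl_E glY0)) => [e|j e].
    by rewrite l1 (gl_labB glg) (gl_labB glG) (gl_labB glY0).
  by rewrite l2 (gl_labF glg) (gl_labF glY0).
- move=> i; apply: (set_colim_ind (gl_E (glY_ i))) => [e|j e].
    rewrite l3 (gl_attB glg) (gl_attF glG) (gl_attB (glY_ i)) -!map_comp.
    by apply: eq_map => x /=; rewrite k3.
  rewrite l4 (gl_attF glg) (gl_attF (glY_ i)) -!map_comp.
  by apply: eq_map => x /=; rewrite k4.
- move=> i; apply: (set_colim_ind (gl_E (glY_ i))) => [e|j e].
    by rewrite l3 (gl_labB glg) (gl_labF glG) (gl_labB (glY_ i)).
  by rewrite l4 (gl_labF glg) (gl_labF (glY_ i)).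
- rewrite (gl_ext glg) (gl_ext glG) (gl_ext glY0) -!map_comp.
  by apply: eq_map => x /=; rewrite k1.
Qed.

Lemma gl_assoc2 (k : gmap Y0 Y_ X) :
  gluing al' k -> exists g : gmap G H X, gluing be g /\ gl_eqs g k.
Proof.
move=> glk.
have [k0 [k_ [kc [k1 k2 k3 k4]]]] := set_colim_assoc2 (gl_V glG) colJ
  (H := fun j => rV (H j)) (S := fun j => zrel (be j) (rext (H j))) S0P S_P
  (gl_V glY0) (fun i => gl_V (glY_ i)) R'P (gl_V glk).
have [l0 [l_ [lc [l1 l2 l3 l4]]]] := set_colim_assoc2 (gl_E glG) colJ (H := fun j => rE (H j))
  (S := @norel J (rE G) (fun j => rE (H j)))
  (fun j g h => E0 (gBE p) g h) (fun i j g h => E0 (gFE p (i := i)) g h)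
  (gl_E glY0) (fun i => gl_E (glY_ i))
  (R' := @norel I (rE Y0) (fun i => rE (Y_ i)))
  (fun i u v => E1 _ _ _ _) (gl_E glk).
exists (Gmap k0 k_ l0 l_); split; last by split.
split=> //=.
- apply: (set_colim_ind (gl_E glG)) => [e|i e].
    rewrite -l1 (gl_attB glk) (gl_attB glG) (gl_attB glY0) -!map_comp.
    by apply: eq_map => x /=; rewrite k1.
  rewrite -l3 (gl_attF glk) (gl_attB (glY_ i)) (gl_attF glG) -!map_comp.
  by apply: eq_map => x /=; rewrite k3.
- apply: (set_colim_ind (gl_E glG)) => [e|i e].
    by rewrite -l1 (gl_labB glk) (gl_labB glG) (gl_labB glY0).
  by rewrite -l3 (gl_labF glk) (gl_labB (glY_ i)) (gl_labF glG).
- apply: (set_colim_ind colJ) => [j|i j] e.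
    rewrite -l2 (gl_attB glk) (gl_attF glY0) -!map_comp.
    by apply: eq_map => x /=; rewrite k2.
  rewrite -l4 (gl_attF glk) (gl_attF (glY_ i)) -!map_comp.
  by apply: eq_map => x /=; rewrite k4.
- apply: (set_colim_ind colJ) => [j|i j] e.
    by rewrite -l2 (gl_labB glk) (gl_labF glY0).
  by rewrite -l4 (gl_labF glk) (gl_labF (glY_ i)).
- rewrite (gl_ext glk) (gl_ext glG) (gl_ext glY0) -!map_comp.
  by apply: eq_map => x /=; rewrite k1.
Qed.
End GlAssoc.

(** * Filling a context and replacing all hyperedges, as gluings *)

Definition is_fill (L : Type) (C K X : raw L) : Prop :=
  exists m : gmap C (fun _ : unit => K) X,
    gluing (fun _ => rhole C) m /\ rhole X = map (gF m (i := tt)) (rhole K).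

(** In a simultaneous replacement all hyperedges of [M] disappear: they become the indices of the
    gluing, their attachments become the strings to be fused, and the base keeps only the nodes. The
    labels of the result may thus live in a new type. *)
Definition no_edges (L L' : Type) (M : raw L) : raw L' :=
  @Raw L' (rV M) void (fun e => match e with end) (fun e => match e with end)
    (rext M) (rhole M).

Definition is_sub (L L' : Type) (M : raw L) (F : rE M -> raw L') (X : raw L') :
    Prop :=
  exists m : gmap (no_edges L' M) F X,
    @gluing L' (no_edges L' M) (rE M) (@ratt L M) F X m /\ rhole X = map (gB m) (rhole M).

Lemma fill_ex (L : Type) (C K : raw L) : exists X, is_fill C K X.
Proof.
have [X [m g]] := @gl_ex L C unit (fun _ => rhole C) (fun _ => K).
exists (set_hole (map (gF m (i := tt)) (rhole K))).
by exists (@Gmap _ C unit (fun _ => K) (set_hole _) (gB m) (@gF _ _ _ _ _ m)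
  (gBE m) (@gFE _ _ _ _ _ m)); split=> //; case: g.
Qed.

Lemma sub_ex (L L' : Type) (M : raw L) (F : rE M -> raw L') :
  exists X, is_sub F X.
Proof.
have [X [m g]] := @gl_ex L' (no_edges L' M) (rE M) (@ratt L M) F.
exists (set_hole (map (gB m) (rhole M))).
by exists (@Gmap _ (no_edges L' M) _ F (set_hole _) (gB m) (@gF _ _ _ _ _ m)
  (gBE m) (@gFE _ _ _ _ _ m)); split=> //; case: g.
Qed.

Lemma set_holeE (L : Type) (X : raw L) : set_hole (rhole X) = X.
Proof. by case: X. Qed.

Lemma fill_uniq (L : Type) (C K X X' : raw L) :
  is_fill C K X -> is_fill C K X' -> riso X X'.
Proof.
case=> m [g h] [m' [g' h']]; rewrite -[X]set_holeE -[X']set_holeE.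
by apply: (gl_uniq g g'); right; right; exists tt, (rhole K).
Qed.

Lemma sub_uniq (L L' : Type) (M : raw L) (F : rE M -> raw L') X X' :
  is_sub F X -> is_sub F X' -> riso X X'.
Proof.
case=> m [g h] [m' [g' h']]; rewrite -[X]set_holeE -[X']set_holeE.
by apply: (gl_uniq g g'); right; left; exists (rhole M).
Qed.

Lemma fill_riso (L : Type) (C C' K K' X X' : raw L) :
  riso C C' -> riso K K' -> riso X X' -> is_fill C K X -> is_fill C' K' X'.
Proof.
case=> jC _ [jK _] [jX _] [m [g h]].
have [m' [g' _ eF]] := gl_transport jC (fun _ => jK) jX g.
exists m'; split; first by rewrite (iso_hole jC).
rewrite (iso_hole jX) h (iso_hole jK) -!map_comp.
by apply: eq_map => x /=; rewrite eF.
Qed.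

Lemma sub_riso (L L' : Type) (M : raw L) (F F' : rE M -> raw L') X X' :
  (forall e, riso (F e) (F' e)) -> riso X X' -> is_sub F X -> is_sub F' X'.
Proof.
move=> /fin_all_exists[jF _] [jX _] [m [g h]].
have [m' [g' eB _]] := gl_transport (isom_refl (no_edges L' M)) jF jX g.
exists m'; split.
  rewrite (_ : @ratt L M = fun i => map (iV (isom_refl (no_edges L' M))) (ratt i)) //.
  by apply: functional_extensionality => e; rewrite map_id.
rewrite (iso_hole jX) h -!map_comp.
by apply: eq_map => x /=; rewrite -eB.
Qed.

(** Bijectivity of [phi] is expressed as a dependent eliminator: a family over [I] may be prescribed
    at the points [phi i]. This avoids transports along [phi (psi i) = i] in the types [B i]. *)
Lemma set_colim_reindex (A X I I' : Type) (B : I -> Type)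
    (R : forall i, A -> B i -> Prop) (a : A -> X) (b : forall i, B i -> X)
    (phi : I' -> I) :
  (forall (P : I -> Type) (f : forall i, P (phi i)),
     exists g : forall i, P i, forall i, g (phi i) = f i) ->
  set_colim R a b -> set_colim (fun i => @R (phi i)) a (fun i => @b (phi i)).
Proof.
move=> dep [E S U]; split=> [i x y|z|T f h fh]; first exact: E.
  case: (S z) => [|[i [y yz]]]; [by left | right].
  have [g _] := dep (fun i => forall y : B i, b i y = z ->
    exists (i : I') (y : B (phi i)), b (phi i) y = z)
    (fun i y yz => ex_intro _ i (ex_intro _ y yz)).
  exact: g yz.
have [h' hE] := dep (fun i => B i -> T) h.
have [|u [ua ub]] := U T f h'.
  move=> i x y Rxy; have [k _] := dep
    (fun i => forall x y, R i x y -> f x = h' i y)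
    (fun i x y Rxy => etrans (fh i x y Rxy)
       (esym (f_equal (fun g => g y) (hE i)))).
  exact: k.
by exists u; split=> // i y; rewrite ub hE.
Qed.

Lemma bij_dep (I' : Type) (I : eqType) (phi : I' -> I) (psi : I -> I') :
  cancel phi psi -> cancel psi phi ->
  forall (P : I -> Type) (f : forall i, P (phi i)),
    exists g : forall i, P i, forall i, g (phi i) = f i.
Proof.
move=> c1 c2 P f.
have [g [gE _]] := set_colim_dep (B := fun _ : void => void) (P := P) f
  (b := fun i => match i with end) (fun i => match i with end)
  (set_colim_bij _ _ c1 c2).
by exists g.
Qed.

Lemma sub_base (L L' : Type) (M M' : raw L) (j : isom M M')
    (F : rE M' -> raw L') X :
  is_sub F X -> is_sub (F \o iE j) X.
Proof.
case=> m [g h].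
pose m' := @Gmap L' (no_edges L' M) _ (F \o iE j) X (gB m \o iV j)
  (fun i => @gF _ _ _ _ _ m (iE j i)) (fun e : void => match e with end)
  (fun i => @gFE _ _ _ _ _ m (iE j i)).
have dep := bij_dep (iEK j) (iEK' j).
have mB t : map (gB m') t = map (gB m) (map (iV j) t) by rewrite map_comp.
exists m'; split; last by rewrite mB -(iso_hole j).
split=> //.
- have := set_colim_reindex dep (gl_V g).
  case=> E S U; split=> [i x y xy|z|T f h' fh].
  + apply: E; rewrite iso_att -[rext _]map_id.
    by apply/zrel_map; exists x, y.
  + case: (S z) => [[x <-]|]; [left|by right].
    by exists (iV' j x); rewrite /= iVK'.
  + have [|u [ua ub]] := U T (f \o iV' j) h'.
      move=> i x y; rewrite iso_att -[rext _]map_id => /zrel_map[x' [y' []]].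
      by move=> -> -> /fh /=; rewrite iVK.
    by exists u; split=> // x; rewrite /= ua /= iVK.
- have := set_colim_reindex dep (gl_E g).
  case=> E S U; split=> // [z|T f h' fh].
    by case: (S z) => [[[]]|]; right.
  have [|u [ua ub]] := U T (fun e : void => match e with end) h'; first by [].
  by exists u; split=> // -[].
- by move=> i e; rewrite (gl_attF g).
- by move=> i e; rewrite (gl_labF g).
- by rewrite (gl_ext g) mB -(iso_ext j).
Qed.

Lemma set_colim_void (I : Type) (R : I -> void -> void -> Prop) :
  set_colim (B := fun _ => void) R id (fun _ => id).
Proof.
split=> [? []|[]|T f h _].
by exists (fun e : void => match e with end); split=> [[]|? []].
Qed.

Lemma gl_no_edges (L L' : Type) (C K X : raw L)
    (m : gmap C (fun _ : unit => K) X) (al : unit -> seq (rV C)) :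
  gluing al m ->
  exists m' : gmap (no_edges L' C) (fun _ : unit => no_edges L' K) (no_edges L' X),
   [/\ @gluing L' (no_edges L' C) _ al _ _ m',
       forall x, gB m' x = gB m x & forall i x, gF m' (i := i) x = gF m (i := i) x].
Proof.
move=> g; exists (@Gmap _ (no_edges L' C) _ (fun _ => no_edges L' K)
  (no_edges L' X) (gB m) (@gF _ _ _ _ _ m) id (fun _ => id)).
split=> //; split=> //; try by case.
- exact: gl_V g.
- by exact: set_colim_void.
- exact: gl_ext g.
Qed.

(** Replacement commutes with filling. The hyperedges of [G] are the disjoint union of those of [C]
    and of [K], so this is associativity with these two index sets; all hyperedges get replaced, so
    only the nodes of [p] enter. *)
Lemma fill_subP (L L' : Type) (C K G : raw L)
    (p : gmap C (fun _ : unit => K) G) :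
  gluing (fun _ => rhole C) p -> rhole G = map (gF p (i := tt)) (rhole K) ->
  forall (F : rE G -> raw L') C0 Z,
    is_sub (F \o gBE p) C0 -> is_sub (F \o gFE p (i := tt)) Z ->
    forall X, is_sub F X <-> is_fill C0 Z X.
Proof.
move=> gp hp F C0 Z [y0 [gy0 hy0]] [y1 [gy1 hy1]] X.
have colJ : set_colim (@norel unit (rE C) (fun _ => rE K)) (gBE p)
    (fun _ => gFE p (i := tt)).
  have := gl_E gp; case=> E S U; split=> // [z|T f h fh].
    by case: (S z) => [|[[] ?]]; [left|right; exists tt].
  by have [//|u [ua ub]] := U T f h; exists u; split=> // [[]].
have [p' [gp' pB pF]] := @gl_no_edges L L' C K G p _ gp.
have pBs s : map (gB p) s = map (gB p') s by apply: eq_map => x; rewrite pB.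
have pFs s : map (gF p (i := tt)) s = map (gF p' (i := tt)) s.
  by apply: eq_map => x; rewrite pF.
have b0 j : ratt (gBE p j) = map (gB p') (ratt j) by rewrite (gl_attB gp).
have b1 (i : unit) (j : rE K) :
    ratt (gFE p (i := tt) j) = map (gF p' (i := i)) (ratt j).
  by case: i; rewrite (gl_attF gp).
split=> [[m [gm hm]]|[m [gm hm]]].
  have [k [gk [e1 e2 e3]]] := gl_assoc1 gp' colJ (be := @ratt L G) b0 b1 gy0
    (fun _ => gy1) gm.
  exists k; rewrite hy0; split=> //.
  rewrite hm hp pFs hy1 -!map_comp; apply: eq_map => x /=.
  by rewrite -(e2 tt).
rewrite hy0 in gm.
have [k [gk [e1 e2 e3]]] := gl_assoc2 gp' colJ (be := @ratt L G) b0 b1 gy0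
    (fun _ => gy1) gm.
exists k; split=> //.
rewrite hm hp pFs hy1 -!map_comp; apply: eq_map => x /=.
by rewrite -(e2 tt).
Qed.

Lemma fill_sub (L L' : Type) (C K G : raw L) :
  is_fill C K G -> exists (pE : rE C -> rE G) (qE : rE K -> rE G),
    [/\ forall e, rlab (pE e) = rlab e, forall e, rlab (qE e) = rlab e,
        set_colim (@norel unit (rE C) (fun _ => rE K)) pE (fun _ => qE)
      & forall (F : rE G -> raw L') C0 Z,
          is_sub (F \o pE) C0 -> is_sub (F \o qE) Z ->
          forall X, is_sub F X <-> is_fill C0 Z X].
Proof.
case=> p [gp hp]; exists (gBE p), (gFE p (i := tt)); split.
- exact: gl_labB gp.
- exact: (gl_labF gp).
- have := gl_E gp; case=> E S U; split=> // [z|T f h fh].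
    by case: (S z) => [|[[] ?]]; [left|right; exists tt].
  by have [//|u [ua ub]] := U T f h; exists u; split=> // [[]].
- exact: fill_subP gp hp.
Qed.

(** Associativity with [J0] empty: every hyperedge of [G] comes from some [F e], so nothing is glued
    onto the bare nodes of [M] and [Y0] is just these nodes. *)
Lemma sub_sub (L L1 L2 : Type) (M : raw L) (F : rE M -> raw L1) (G : raw L1) :
  is_sub F G -> exists qE : forall e, rE (F e) -> rE G,
    [/\ forall e y, rlab (qE e y) = rlab y,
        set_colim (@norel (rE M) void (fun e => rE (F e)))
          (fun v : void => match v with end) qE
      & forall (H : rE G -> raw L2) (Y : rE M -> raw L2),
          (forall e, is_sub (H \o qE e) (Y e)) ->
          forall X, is_sub H X <-> is_sub Y X].
Proof.
case=> p [gp hp]; exists (@gFE _ _ _ _ _ p).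
have colJ : set_colim (@norel (rE M) void (fun e => rE (F e)))
    (fun v : void => match v with end) (@gFE _ _ _ _ _ p).
  have := gl_E gp; case=> E S U; split=> // [z|T f h fh].
    by case: (S z) => [[[]]|]; right.
  by have [//|u [ua ub]] := U T f h; exists u; split=> // [[]].
split=> // [e y|H Y /fin_all_exists[y_ y_P] X]; first exact: (gl_labF gp).
have gy_ i := (y_P i).1; have hy_ i := (y_P i).2.
pose p' := @Gmap L2 (no_edges L2 M) _ (fun e => no_edges L2 (F e))
  (no_edges L2 G) (gB p) (@gF _ _ _ _ _ p) id (fun _ => id).
have gp' : @gluing L2 (no_edges L2 M) _ (@ratt L M) _ _ p'.
  split=> //; try by case.
  - exact: gl_V gp.
  - exact: set_colim_void.
  - exact: gl_ext gp.
pose j0 (v : void) : rE G := match v with end.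
pose y0 := @Gmap L2 (no_edges L2 M) void (H \o j0) (no_edges L2 M)
  id (fun v => match v with end) id (fun v => match v with end).
have gy0 : @gluing L2 (no_edges L2 M) void (fun v => match v with end) _ _ y0.
  split=> //; try by case.
  - by apply: (set_colim_bij (phi := id) (psi := id)).
  - by apply: (set_colim_bij (phi := id) (psi := id)).
  - by rewrite map_id.
have b0 (v : void) : ratt (j0 v) = map (gB p') (match v with end) by case: v.
have b1 i (j : rE (F i)) : ratt (gFE p j) = map (gF p' (i := i)) (ratt j).
  by rewrite (gl_attF gp).
have aM (i : rE M) : ratt i = map (gB y0) (ratt i) by rewrite map_id.
split=> [[m [gm hm]]|[m [gm hm]]].
  have [k [gk [e1 e2 e3]]] := gl_assoc1 gp' colJ (be := @ratt L1 G) b0 b1 gy0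
    gy_ gm.
  exists k; split; first by rewrite (functional_extensionality _ _ aM).
  by rewrite hm hp -map_comp; apply: eq_map => x /=; rewrite -e1.
rewrite (functional_extensionality _ _ aM) in gm.
have [k [gk [e1 e2 e3]]] := gl_assoc2 gp' colJ (be := @ratt L1 G) b0 b1 gy0
    gy_ gm.
exists k; split=> //.
by rewrite hm hp -map_comp; apply: eq_map => x /=; rewrite -e1.
Qed.

(** Composition of contexts. The content of a filling may itself have a hole, which the result
    inherits. The hole of [G] lies in [C0], so associativity applies with a single index, and that
    index belongs to [C0]. *)
Lemma fill_fill (L : Type) (C C0 K G Z : raw L) :
  is_fill C C0 G -> is_fill C0 K Z ->
  forall X, is_fill G K X <-> is_fill C Z X.
Proof.
case=> p [gp hp] [y1 [gy1 hy1]] X.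
have colJ : set_colim (@norel unit void (fun _ => unit))
    (fun v : void => match v with end) (fun _ => id).
  split=> // [z|T f h fh]; first by right; exists tt, z.
  by exists (h tt); split=> [[]|[] []].
pose j0 (v : void) : unit := match v with end.
pose y0 := @Gmap L C void ((fun _ => K) \o j0) C
  id (fun v => match v with end) id (fun v => match v with end).
have gy0 : @gluing L C void (fun v => match v with end) _ _ y0.
  split=> //; try by case.
  - by apply: (set_colim_bij (phi := id) (psi := id)).
  - by apply: (set_colim_bij (phi := id) (psi := id)).
  - by move=> e; rewrite map_id.
  - by rewrite map_id.
have b0 (v : void) : rhole G = map (gB p) (match v with end) by case: v.
have b1 (i : unit) (j : unit) : rhole G = map (gF p (i := i)) (rhole C0).
  by case: i.
have gy (i : unit) : gluing (fun _ => rhole C0) y1 by [].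
have aC : (fun _ : unit => rhole C) = (fun _ => map (gB y0) (rhole C)).
  by apply: functional_extensionality => _; rewrite map_id.
split=> [[m [gm hm]]|[m [gm hm]]].
  have [k [gk [e1 e2 e3]]] := gl_assoc1 (Y_ := fun _ => Z) gp colJ
    (be := fun _ => rhole G) b0 b1 gy0 gy gm.
  exists k; split; first by rewrite aC.
  by rewrite hm hy1 -!map_comp; apply: eq_map => x /=; rewrite -(e3 tt tt).
rewrite aC in gm.
have [k [gk [e1 e2 e3]]] := gl_assoc2 (Y_ := fun _ => Z) gp colJ
  (be := fun _ => rhole G) b0 b1 gy0 gy gm.
exists k; split=> //.
by rewrite hm hy1 -!map_comp; apply: eq_map => x /=; rewrite -(e3 tt tt).
Qed.

(** * Handles, unit laws and replacement of a single hyperedge *)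

Definition graph (L : Type) (k : nat) (Z : raw L) : Prop :=
  size (rext Z) = k /\ rhole Z = [::].

Definition rhandle (L : Type) (k : nat) (x : L) : raw L :=
  @Raw L 'I_k unit (fun _ => ord_tuple k) (fun _ => x) (ord_tuple k) [::].

Definition relab (L L' : Type) (Z : raw L) (f : rE Z -> L') : raw L' :=
  Raw (@ratt L Z) f (rext Z) (rhole Z).

Lemma zrel_tnth (T U : eqType) k (s : k.-tuple T) (t : k.-tuple U) x y :
  zrel s t x y <-> exists i, x = tnth s i /\ y = tnth t i.
Proof.
rewrite /zrel -(map_tnth_enum s) -(map_tnth_enum t) zip_map; split.
  by case/mapP=> l _ [-> ->]; exists l.
case=> i [-> ->]; apply/mapP; exists i => //.
exact: mem_enum.
Qed.

Lemma zrel_ordl (U : eqType) k (t : seq U) (t_k : size t = k) x y :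
  zrel (ord_tuple k) t x y <-> y = tnth (Tuple (introT eqP t_k)) x.
Proof.
have := zrel_tnth (ord_tuple k) (Tuple (introT eqP t_k)) x y => -> /=.
by split=> [[i [-> ->]]|->]; [|exists x]; rewrite tnth_ord_tuple.
Qed.

Lemma zrel_ordr (U : eqType) k (t : seq U) (t_k : size t = k) x y :
  zrel t (ord_tuple k) x y <-> x = tnth (Tuple (introT eqP t_k)) y.
Proof.
have := zrel_tnth (Tuple (introT eqP t_k)) (ord_tuple k) x y => -> /=.
by split=> [[i [-> ->]]|->]; [|exists y]; rewrite tnth_ord_tuple.
Qed.

Lemma tnth_enum_map (U : Type) k (t : seq U) (t_k : size t = k) :
  map (tnth (Tuple (introT eqP t_k))) (ord_tuple k) = t.
Proof. by rewrite val_ord_tuple map_tnth_enum. Qed.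

Lemma sub_handle (L L' : Type) k (x : L) (F : rE (rhandle k x) -> raw L') :
  graph k (F tt) -> is_sub F (F tt).
Proof.
case=> sz ho.
pose tn := tnth (Tuple (introT eqP sz)).
exists (@Gmap L' (no_edges L' (rhandle k x)) _ F (F tt) tn
  (fun i => match i with tt => id end) (fun e : void => match e with end)
  (fun i => match i with tt => id end)); split=> //.
split=> //.
- split=> [[] u v /(zrel_ordl sz)|z|T f h fh] //.
    by right; exists tt, z.
  exists (h tt); split=> [u|[] //].
  by apply/esym/fh/(zrel_ordl sz).
- split=> // [z|T f h fh]; first by right; exists tt, z.
  by exists (h tt); split=> // [[]].
- by case=> e /=; rewrite map_id.
- by case.
- by rewrite /tn [RHS]tnth_enum_map.
Qed.

Lemma sub_unit (L L' : Type) (Z : raw L) (k : rE Z -> nat) (f : rE Z -> L') :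
  (forall e, size (ratt e) = k e) ->
  is_sub (fun e => rhandle (k e) (f e)) (relab f).
Proof.
move=> sz.
exists (@Gmap L' (no_edges L' Z) _ (fun e => rhandle (k e) (f e)) (relab f) id
  (fun e => tnth (Tuple (introT eqP (sz e)))) (fun e : void => match e with end)
  (fun e _ => e)); split=> //; last by rewrite map_id.
split=> //.
- split=> [e u v /(zrel_ordr (sz e))|z|T g h gh] //; first by left; exists z.
  by exists g; split=> // e y; apply/gh/(zrel_ordr (sz e)).
- split=> // [z|T g h gh]; first by right; exists z, tt.
  by exists (fun e => h e tt); split=> // e [].
- by move=> e [] /=; rewrite [RHS]tnth_enum_map.
- by rewrite map_id.
Qed.

Definition remove_edge (L : Type) (Z : raw L) (e : rE Z) : raw L :=
  @Raw L (rV Z) {e' : rE Z | e' != e} (fun e' => ratt (val e'))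
    (fun e' => rlab (val e')) (rext Z) (ratt e).

Lemma fill_remove (L : Type) (Z : raw L) (e : rE Z) :
  rhole Z = [::] ->
  is_fill (remove_edge e) (rhandle (size (ratt e)) (rlab e)) Z.
Proof.
move=> ho; have sz : size (ratt e) = size (ratt e) by [].
exists (@Gmap L (remove_edge e) _ (fun _ => rhandle (size (ratt e)) (rlab e)) Z
  id (fun _ => tnth (Tuple (introT eqP sz))) val (fun _ _ => e)); split=> //.
split=> //.
- split=> [_ u v /(zrel_ordr sz)|z|T g h gh] //; first by left; exists z.
  by exists g; split=> // i y; apply/gh/(zrel_ordr sz).
- split=> // [z|T g h gh].
    have [->|ze] := eqVneq z e; first by right; exists tt, tt.
    by left; exists (exist _ z ze).
  exists (fun z => match insub z with Some z' => g z' | None => h tt tt end).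
  split=> [x|[] []] /=; case: insubP => [u|] //=.
  - by move=> _ /val_inj ->.
  - by rewrite (valP x).
  - by rewrite eqxx.
- by move=> e' /=; rewrite map_id.
- by move=> ? ? /=; rewrite [RHS]tnth_enum_map.
- by rewrite /= map_id.
Qed.

(** Removing [e], keeping its attachment as hole and carrying out all other replacements gives a
    context that does not depend on what is put at [e]. *)
Lemma sub_context (L L' : Type) (M : raw L) (Y : rE M -> raw L') (e : rE M) :
  rhole M = [::] ->
  exists C, size (rhole C) = size (ratt e) /\
    forall Z X, graph (size (ratt e)) Z ->
      is_sub (fun e' => if e' == e then Z else Y e') X <-> is_fill C Z X.
Proof.
move=> ho.
(* Labelling each hyperedge by itself identifies the label-preserving maps [pE] and [qE]: the former
   must be [val], the latter constantly [e]. *)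
pose M' := relab (Z := M) id; pose e' : rE M' := e.
have [C0 C0P] := @sub_ex _ _ (remove_edge e') (Y \o val).
exists C0; split=> [|Z X gZ].
  by have [m [_ ->]] := C0P; rewrite size_map.
have [pE [qE [p1 q1 _ H]]] := @fill_sub _ L' _ _ _ (@fill_remove _ M' e' ho).
pose F (f : rE M') := if f == e' then Z else Y f.
apply: (H F).
  suff -> : F \o pE = Y \o val by [].
  apply: functional_extensionality => x; have /= px := p1 x.
  by rewrite /F /= px (negbTE (valP x)).
have -> : F \o qE = fun _ => Z.
  by apply: functional_extensionality => x; have /= := q1 x; rewrite /F /= => ->; rewrite eqxx.
exact: (@sub_handle _ _ _ _ (fun _ => Z)).
Qed.

(* Replaces the components one at a time, each time inside a context. *)
Lemma sub_stepwise (L L' : Type) (M : raw L) (Y Y' : rE M -> raw L')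
    (Q : raw L' -> Prop) :
  rhole M = [::] ->
  (forall X X', riso X X' -> Q X -> Q X') ->
  (forall e, graph (size (ratt e)) (Y e)) ->
  (forall e, graph (size (ratt e)) (Y' e)) ->
  (forall e C X X', size (rhole C) = size (ratt e) ->
    is_fill C (Y e) X -> is_fill C (Y' e) X' -> Q X -> Q X') ->
  forall X X', is_sub Y X -> is_sub Y' X' -> Q X -> Q X'.
Proof.
move=> ho Qi gY gY' QY X X' YX YX' QX.
pose YY (s : seq (rE M)) e := if e \in s then Y' e else Y e.
have QS s : uniq s -> forall W, is_sub (YY s) W -> Q W.
  elim: s => [_ W WP|e s IH /= /andP[es us] W WP].
    exact: Qi (sub_uniq YX WP) QX.
  have [W0 W0P] := sub_ex (YY s).
  have [C [hC CP]] := sub_context (YY s) e ho.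
  apply: (QY e C _ _ hC _ _ (IH us W0 W0P)); apply/CP => //.
    suff -> : (fun e' => if e' == e then Y e else YY s e') = YY s by [].
    apply: functional_extensionality => e'; case: eqP => // ->.
    by rewrite /YY (negbTE es).
  suff -> : (fun e' => if e' == e then Y' e else YY s e') = YY (e :: s) by [].
  apply: functional_extensionality => e'; rewrite /YY in_cons.
  by case: eqP => // ->.
apply: (QS (enum (rE M))); first exact: enum_uniq.
suff -> : YY (enum (rE M)) = Y' by [].
by apply: functional_extensionality => e; rewrite /YY mem_enum.
Qed.

(** * Typed hypergraphs as untyped ones whose labels carry the rank *)

Definition of_hg (L : nat -> Type) (n : nat) (G : hg L n) : raw {k & L k} :=
  @Raw {k & L k} (hV G) (hE G) (fun e => hatt G e)
    (fun e => Tagged L (hlab G e)) (hext G) [::].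

Definition of_ctx (L : nat -> Type) (n m : nat) (C : ctx L n m) :
    raw {k & L k} :=
  @Raw {k & L k} (cV C) (cE C) (fun e => catt C e)
    (fun e => Tagged L (clab C e)) (cext C) (chole C).

Lemma of_hg_graph (L : nat -> Type) (n : nat) (G : hg L n) : graph n (of_hg G).
Proof. by split=> //=; rewrite size_tuple. Qed.

Lemma fill_of (L : nat -> Type) (n m : nat) (C : ctx L n m) (F : hg L m) :
  is_fill (of_ctx C) (of_hg F) (of_hg (fill C F)).
Proof.
exists (@Gmap _ (of_ctx C) _ (fun _ => of_hg F) (of_hg (fill C F))
  (fun x => @fill_pi L n m C F (inl x)) (fun _ x => @fill_pi L n m C F (inr x))
  inl (fun _ => inr)); split=> //.
split=> //=; split=> [i x y xy|z|T f h fh].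
- by apply: fuse_piP; apply/mapP; exists (x, y).
- case E1: (val z) => [x|x]; [left; exists x | right; exists tt, x];
    by rewrite -[z]fuse_pi_val E1.
- pose w (t : (cV C + hV F)%type) := match t with inl x => f x | inr y => h tt y end.
  have ws p : p \in fill_pairs C F -> w p.1 = w p.2.
    by case/mapP=> [[x y] xy ->] /=; apply: fh.
  by exists (w \o val); split=> [x|[] y]; exact: (fuse_univ ws).
- by [].
- by case: z => x; [left; exists x | right; exists tt, x].
- exists (fun e => match e with inl x => f x | inr y => h tt y end).
  by split=> // [[]].
Qed.

Lemma subst_of (L L' : nat -> Type) (n : nat) (M : hg L n)
    (F : forall e : hE M, hg L' (har M e)) :
  exists m : gmap (no_edges {k & L' k} (of_hg M)) (fun e : hE M => of_hg (F e))
               (of_hg (subst F)),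
    (forall x, gB m x = @subst_pi L L' n M F (inl x)) /\
    @gluing _ (no_edges {k & L' k} (of_hg M)) _ (fun e : hE M => hatt M e) _ _ m.
Proof.
exists (@Gmap _ (no_edges _ (of_hg M)) _ (fun e : hE M => of_hg (F e))
  (of_hg (subst F)) (fun x => @subst_pi L L' n M F (inl x))
  (fun e x => @subst_pi L L' n M F (copy_node x)) (fun e : void => match e with end)
  (fun e y => Tagged (fun e => hE (F e)) y)); split=> //.
split=> //=; split=> [i x y xy|z|T f h fh].
- apply: fuse_piP; apply/flattenP.
  exists [seq (inl p.1 : subst_node F, copy_node p.2)
    | p <- zip (hatt M i) (hext (F i))].
    by apply/mapP; exists i; rewrite ?mem_enum.
  by apply/mapP; exists (x, y).
- case E1: (val z) => [x|[i y]]; [left; exists x | right; exists i, y];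
    by rewrite -[z]fuse_pi_val E1.
- pose w (t : subst_node F) :=
    match t with inl x => f x | inr y => h _ (tagged y) end.
  have ws p : p \in subst_pairs F -> w p.1 = w p.2.
    case/flattenP=> _ /mapP[i _ ->] /mapP[[x y] xy ->] /=; exact: fh.
  by exists (w \o val); split=> [x|i y]; exact: (fuse_univ ws).
- by [].
- by case: z => i y; right; exists i, y.
- by exists (fun e => h _ (tagged e)).
Qed.

Lemma sub_of (L L' : nat -> Type) (n : nat) (M : hg L n)
    (F : forall e : hE M, hg L' (har M e)) :
  is_sub (M := of_hg M) (fun e => of_hg (F e)) (of_hg (subst F)).
Proof. by have [m [_ g]] := subst_of F; exists m. Qed.

Lemma ctx_sub_of (L L' : nat -> Type) (n m : nat) (D : ctx L n m)
    (F : forall e : cE D, hg L' (car D e)) :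
  is_sub (M := of_ctx D) (fun e => of_hg (F e)) (of_ctx (ctx_subst F)).
Proof.
have [k [kB g]] := @subst_of L L' n (ctx_rest D) F.
exists (@Gmap _ (no_edges {k & L' k} (of_ctx D)) (cE D) (fun e => of_hg (F e))
  (of_ctx (ctx_subst F)) (gB k) (@gF _ _ _ _ _ k) (gBE k) (@gFE _ _ _ _ _ k)).
split; first by case: g => *; split.
by apply: eq_map => x; rewrite -kB.
Qed.

Lemma hiso_riso (L : nat -> Type) (n : nat) (G H : hg L n) :
  hiso G H <-> riso (of_hg G) (of_hg H).
Proof.
split=> [[f [[g fK gK] [h eK hK] ef]]|[j _]].
  unshelve eexists (@Isom _ (of_hg G) (of_hg H) (mV f) g (mE f) h
    fK gK eK hK _ _ _ _) => //= e; [exact/esym/morph_att|exact/esym/morph_lab].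
unshelve eexists (@Morph L n n G H (iV j) (iE j) _ _) => [e|e|].
- exact/esym/(iso_att j).
- exact/esym/(iso_lab j).
split.
- exact: Bijective (iVK j) (iVK' j).
- exact: Bijective (iEK j) (iEK' j).
- exact: (iso_ext j).
Qed.

(** * Well-typedness *)

Definition ranked_raw (L : nat -> Type) (X : raw {k & L k}) : Prop :=
  forall e : rE X, size (ratt e) = tag (rlab e).

Lemma of_hg_ranked (L : nat -> Type) (n : nat) (G : hg L n) :
  ranked_raw (of_hg G).
Proof. by move=> e; rewrite /= size_tuple. Qed.

Lemma ctx_ex (L : nat -> Type) (n m : nat) (C : raw {k & L k}) :
  ranked_raw C -> size (rext C) = n -> size (rhole C) = m ->
  exists D : ctx L n m, riso (of_ctx D) C.
Proof.
move=> rC sn sm.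
pose D := (@Ctx L n m (rV C) (rE C) (fun e => tag (rlab e))
  (fun e => Tuple (introT eqP (rC e))) (fun e => tagged (rlab e))
  (Tuple (introT eqP sn)) (Tuple (introT eqP sm))).
exists D; unshelve eexists (@Isom _ (of_ctx D) C id id id id _ _ _ _ _ _ _ _) => //= *;
  rewrite ?map_id //; by case: (rlab _).
Qed.

Lemma hg_ex (L : nat -> Type) (n : nat) (X : raw {k & L k}) :
  ranked_raw X -> graph n X -> exists G : hg L n, riso (of_hg G) X.
Proof.
move=> rX [sn hX].
have [|D [j _]] := @ctx_ex L n 0 X rX sn; first by rewrite hX.
exists (ctx_rest D).
unshelve eexists (@Isom _ (of_hg (ctx_rest D)) X (iV j) (iV' j) (iE j) (iE' j)
  (iVK j) (iVK' j) (iEK j) (iEK' j) _ _ _ _) => //.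
- exact: (iso_att j).
- exact: (iso_lab j).
- exact: (iso_ext j).
Qed.

Lemma fill_ranked (L : nat -> Type) (C K X : raw {k & L k}) :
  is_fill C K X -> ranked_raw C -> ranked_raw K -> ranked_raw X.
Proof.
case=> m [g _] rC rK; apply: (set_colim_ind (gl_E g)) => [e|i e].
  by rewrite (gl_attB g) (gl_labB g) size_map.
by rewrite (gl_attF g) (gl_labF g) size_map.
Qed.

Lemma fill_ranked_ctx (L : nat -> Type) (C K X : raw {k & L k}) :
  is_fill C K X -> ranked_raw X -> ranked_raw C.
Proof.
by case=> m [g _] rX e; rewrite -(gl_labB g) -rX (gl_attB g) size_map.
Qed.

Lemma riso_ranked (L : nat -> Type) (X Y : raw {k & L k}) :
  riso X Y -> ranked_raw X -> ranked_raw Y.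
Proof.
by case=> j _ rX e; rewrite -(iEK' j e) iso_att iso_lab size_map.
Qed.

Lemma fill_graph (L : Type) (k : nat) (C K X : raw L) :
  is_fill C K X -> rhole K = [::] ->
  graph k X <-> size (rext C) = k.
Proof.
case=> m [g h] hK; rewrite /graph h hK (gl_ext g) size_map /=.
by split=> [[]|].
Qed.

Lemma sub_graph (L L' : Type) (k : nat) (M : raw L) (F : rE M -> raw L') X :
  is_sub F X -> graph k M -> graph k X.
Proof.
by case=> m [g h] [sM hM]; rewrite /graph h hM (gl_ext g) size_map.
Qed.

Lemma riso_graph (L : Type) (k : nat) (X Y : raw L) :
  riso X Y -> graph k X -> graph k Y.
Proof.
by case=> j _ [sX hX]; rewrite /graph (iso_ext j) (iso_hole j) size_map hX.
Qed.

(** * Pushouts along discrete interfaces *)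

Definition with_ext (L : nat -> Type) (k : nat) (K : hg L 0)
    (phi : morph (Dis L k) K) : hg L k :=
  Hg (hatt K) (hlab K) (map_tuple (mV phi) (ord_tuple k)).

Lemma zrel_diag (T : eqType) (s : seq T) x y :
  zrel s s x y <-> x = y /\ x \in s.
Proof.
rewrite /zrel -[X in zip X _]map_id -[X in zip _ X]map_id zip_map.
by split=> [/mapP[z zs [-> ->]]|[<- xs]] //; apply/mapP; exists x.
Qed.

(** The filling fuses the [l]-th hole node with the [l]-th external node of [with_ext phi], that is,
    the two images of the interface node [l]. This is the identification made by the pushout; the
    interface has no hyperedges, so the hyperedges simply form a disjoint union. *)
Lemma fill_pushout (L : nat -> Type) (n k : nat) (K : hg L 0)
    (phi : morph (Dis L k) K) (C : ctx L n k)
    (d : morph (Dis L k) (ctx_rest C)) (P : hg L n) :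
  map (mV d) (ord_tuple k) = chole C ->
  is_fill (of_ctx C) (of_hg (with_ext phi)) (of_hg P) ->
  exists (i : morph K P) (j : morph (ctx_rest C) P),
    is_pushout phi d i j /\ hext P = map (mV j) (cext C) :> seq (hV P).
Proof.
move=> dC [m [g _]].
unshelve eexists (@Morph L 0 n K P (gF m (i := tt)) (gFE m (i := tt)) _ _).
- by move=> e; rewrite -[RHS]/(ratt (gFE m (i := tt) e)) (gl_attF g).
- by move=> e; rewrite -[RHS]/(rlab (gFE m (i := tt) e)) (gl_labF g).
unshelve eexists (@Morph L n n (ctx_rest C) P (gB m) (gBE m) _ _).
- by move=> e; rewrite -[RHS]/(ratt (gBE m e)) (gl_attB g).
- by move=> e; rewrite -[RHS]/(rlab (gBE m e)) (gl_labB g).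
have hz i x y : zrel (rhole (of_ctx C)) (rext (of_hg (with_ext phi))) x y <->
    exists l : 'I_k, [/\ x = mV d l, y = mV phi l & i = tt].
  rewrite /= -dC zrel_map; split=> [[l [l' [-> ->]]]|[l [-> -> _]]].
    by move/zrel_diag=> [-> _]; exists l'; case: i.
  by exists l, l; split=> //; apply/zrel_diag; rewrite mem_enum.
split; last exact: (gl_ext g).
split=> /= [l|[]|x X u v uv _].
  by have [E _ _] := gl_V g; apply/esym/(E tt); apply/(hz tt); exists l.
have [|f [fB fF]] := (let: And3 _ _ U := gl_V g in U) _ (mV v) (fun _ => mV u).
  by move=> i y z /(hz i)[l [-> -> _]]; have /esym := uv l.
have [//|h [hB hF]] := (let: And3 _ _ U := gl_E g in U) _ (mE v) (fun _ => mE u).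
split.
  unshelve eexists (@Morph L n x P X f h _ _).
  - apply: (set_colim_ind (gl_E g)) => [e|i e].
      rewrite hB -(morph_att v).
      apply: etrans (congr1 (map f) (gl_attB g e)) _; rewrite -map_comp.
      by apply: eq_map => y /=; rewrite fB.
    rewrite hF -(morph_att u).
    apply: etrans (congr1 (map f) (gl_attF g (i := i) e)) _; rewrite -map_comp.
    by apply: eq_map => y /=; rewrite fF.
  - apply: (set_colim_ind (gl_E g)) => [e|i e].
      by rewrite hB -(morph_lab v); apply: (gl_labB g).
    by rewrite hF -(morph_lab u); apply: (gl_labF g).
  by split=> y /=; rewrite ?fB ?fF ?hB ?hF.
move=> w w' [w1 w2 w3 w4] [w1' w2' w3' w4']; split.
  apply: (set_colim_ind (gl_V g)) => [y|[] y].
    by rewrite -[LHS]/((mV w \o gB m) y) w3 -w3'.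
  by rewrite -[LHS]/((mV w \o gF m (i := tt)) y) w1 -w1'.
apply: (set_colim_ind (gl_E g)) => [y|[] y].
  by rewrite -[LHS]/((mE w \o gBE m) y) w4 -w4'.
by rewrite -[LHS]/((mE w \o gFE m (i := tt)) y) w2 -w2'.
Qed.

Definition morph_id (L : nat -> Type) (n : nat) (G : hg L n) : morph G G.
Proof. by apply: (@Morph L n n G G id id) => // e; rewrite map_id. Defined.

Definition morph_comp (L : nat -> Type) (a b c : nat) (A : hg L a) (B : hg L b)
  (C : hg L c) (g : morph B C) (f : morph A B) : morph A C.
Proof.
apply: (@Morph L a c A C (mV g \o mV f) (mE g \o mE f)) => e.
  by rewrite map_comp morph_att morph_att.
exact: etrans (morph_lab f e) (morph_lab g _).
Defined.

Lemma pushout_uniq (L : nat -> Type) (a b c p q : nat)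
    (A : hg L a) (B : hg L b) (C : hg L c) (P : hg L p) (Q : hg L q)
    (f : morph A B) (g : morph A C) (i : morph B P) (j : morph C P)
    (i' : morph B Q) (j' : morph C Q) :
  is_pushout f g i j -> is_pushout f g i' j' ->
  exists h : morph P Q, [/\ bijective (mV h), bijective (mE h)
    & mV h \o mV j =1 mV j'].
Proof.
case=> cV cE U [cV' cE' U'].
have [[h [h1 h2 h3 h4]] _] := U _ Q i' j' cV' cE'.
have [[h' [h1' h2' h3' h4']] _] := U' _ P i j cV cE.
have [_ u] := U _ P i j cV cE; have [_ u'] := U' _ Q i' j' cV' cE'.
have [|//|eV eE] := u (morph_comp h' h) (morph_id P).
  split=> x /=.
  - exact: etrans (congr1 (mV h') (h1 x)) (h1' x).
  - exact: etrans (congr1 (mE h') (h2 x)) (h2' x).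
  - exact: etrans (congr1 (mV h') (h3 x)) (h3' x).
  - exact: etrans (congr1 (mE h') (h4 x)) (h4' x).
have [|//|eV' eE'] := u' (morph_comp h h') (morph_id Q).
  split=> x /=.
  - exact: etrans (congr1 (mV h) (h1' x)) (h1 x).
  - exact: etrans (congr1 (mE h) (h2' x)) (h2 x).
  - exact: etrans (congr1 (mV h) (h3' x)) (h3 x).
  - exact: etrans (congr1 (mE h) (h4' x)) (h4 x).
exists h; split=> //.
- by exists (mV h').
- by exists (mE h').
Qed.

(** The pushout complement, with the image of the interface as hole, is the common context of both
    sides. In one direction uniqueness of pushouts identifies the filling with the given hypergraph.
    In the other, [C] inherits the rank discipline from [G] and is therefore a typed context. *)
Lemma dpo_applyP (L : nat -> Type) (r : dpo_rule L) (n : nat) (G H : hg L n) :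
  dpo_apply r G H <->
  exists C, [/\ size (rhole C) = interface r,
    is_fill C (of_hg (with_ext (phiL r))) (of_hg G)
    & is_fill C (of_hg (with_ext (phiR r))) (of_hg H)].
Proof.
split.
  (* [D] is destructured so that [ctx_rest C] is convertible to it and [d] can be used without
     transport. *)
  case=> [[V E ar att lab ext]] [d [mL [g [mR [h [poL poR eG eH]]]]]].
  pose C := Ctx att lab ext (map_tuple (mV d) (ord_tuple (interface r))).
  have side K (phi : morph (Dis L (interface r)) K) (P : hg L n)
      (i : morph K P) (j : morph (ctx_rest C) P) :
      is_pushout phi d i j -> hext P = map (mV j) ext :> seq _ ->
      is_fill (of_ctx C) (of_hg (with_ext phi)) (of_hg P).
    move=> po eP.
    have fl := fill_of C (with_ext phi).
    have [i0 [j0 [po0 e0]]] := @fill_pushout _ _ _ _ phi C d _ erefl fl.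
    have [k [bV bE kj]] := pushout_uniq po0 po.
    apply: (fill_riso (riso_refl _) (riso_refl _) _ fl).
    apply/hiso_riso; exists k; split=> //.
    rewrite eP e0 -map_comp; apply: eq_map => x; exact/esym/kj.
  exists (of_ctx C); split; [|exact: side poL eG|exact: side poR eH].
  by rewrite size_tuple.
case=> C [hC fG fH].
have rC := fill_ranked_ctx fG (@of_hg_ranked _ _ G).
have sC : size (rext C) = n by apply/(fill_graph _ fG) => //; apply: of_hg_graph.
have [D [jD _]] := ctx_ex rC sC hC.
have iD : riso C (of_ctx D) by exists (isom_sym jD).
have fG' := fill_riso iD (riso_refl _) (riso_refl _) fG.
have fH' := fill_riso iD (riso_refl _) (riso_refl _) fH.
unshelve epose (d := @Morph L 0 n (Dis L (interface r)) (ctx_rest D)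
  (tnth (chole D)) (fun e => match e with end) _ _); [by case|by case|].
have dD : map (mV d) (ord_tuple (interface r)) = chole D.
  by rewrite val_ord_tuple map_tnth_enum.
have [i [j [po e]]] := fill_pushout dD fG'.
have [i' [j' [po' e']]] := fill_pushout dD fH'.
by exists (ctx_rest D), d, i, j, i', j'.
Qed.

(** * Decorated derivations *)

Definition deco (B T : Type) (Z : raw B) (K : finType) (ka : K -> T) :
    raw (B + T) :=
  @Raw (B + T) (rV Z) (rE Z + K)%type
    (fun e => match e with inl e => ratt e | inr _ => [::] end)
    (fun e => match e with inl e => inl (rlab e) | inr k => inr (ka k) end)
    (rext Z) (rhole Z).

(* [tnth] is unusable here for universe reasons: rules contain [finType]s. *)
Definition lookup (T : Type) (s : seq T) : 'I_(size s) -> T :=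
  match s with
  | [::] => fun i => False_rect T (Bool.diff_false_true (ltn_ord i))
  | x :: s' => fun i => nth x (x :: s') i
  end.

Lemma lookup_In (T : Type) (s : seq T) i : List.In (@lookup T s i) s.
Proof.
case: s i => [[]|x s i] //=.
case: i => m /=; elim: m x s => [|m IH] x [|y s] //=; first by left.
  by left.
move=> lt; right; have := IH y s lt.
by rewrite (set_nth_default x).
Qed.

Lemma In_lookup (T : Type) (s : seq T) r :
  List.In r s -> exists i, @lookup T s i = r.
Proof.
case: s => // x s rs.
suff [m lt <-] : exists2 m, m < size (x :: s) & nth x (x :: s) m = r.
  by exists (Ordinal lt).
elim: (x :: s) rs => //= y t IH [->|/IH[m lt e]]; first by exists 0.
by exists m.+1.
Qed.

Section Decorated.
Variables (N S : ranked) (HGr : dpo_grammar N S).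

Definition rule_ix : finType := 'I_(size (dpo_rules HGr)).
Definition rule (i : rule_ix) : dpo_rule (fib (ranked_sum N S)) :=
  lookup i.
Definition dlabel : Type := ({k & fib (ranked_sum N S) k} + rule_ix)%type.

Definition lraw (i : rule_ix) : raw dlabel :=
  deco (of_hg (with_ext (phiL (rule i)))) (fun v : void => match v with end).
Definition rraw (i : rule_ix) : raw dlabel :=
  deco (of_hg (with_ext (phiR (rule i)))) (fun _ : unit => i).

(* One step, leaving behind a hyperedge that records the rule. *)
Definition dstep (X Y : raw dlabel) : Prop :=
  exists i C, [/\ size (rhole C) = interface (rule i),
    is_fill C (lraw i) X & is_fill C (rraw i) Y].

Inductive der (X : raw dlabel) : raw dlabel -> Prop :=
| der0 Y : riso X Y -> der X Y
| derS Y Z : dstep X Y -> der Y Z -> der X Z.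

Lemma dstep_riso X X' Y : riso X' X -> dstep X Y -> dstep X' Y.
Proof.
move=> /riso_sym j [i [C [h l r]]]; exists i, C; split=> //.
exact: fill_riso (riso_refl _) (riso_refl _) j l.
Qed.

Lemma der_risol X X' Y : riso X' X -> der X Y -> der X' Y.
Proof.
move=> j d; elim: d j => {X Y} [X Y j' j|X Y Z xy yz _ j].
  by apply: der0; apply: riso_trans j j'.
by apply: derS yz; apply: dstep_riso xy.
Qed.

Lemma der_trans X Y Z : der X Y -> der Y Z -> der X Z.
Proof.
move=> d; elim: d Z => {X Y} [X Y j|X Y W xy _ IH] Z.
  exact: der_risol.
by move/IH; apply: derS.
Qed.

Lemma dstep_ctx Z Z' C X X' :
  dstep Z Z' -> is_fill C Z X -> is_fill C Z' X' -> dstep X X'.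
Proof.
move=> [i [C0 [h l r]]] fX fX'.
have [CC fC] := fill_ex C C0.
exists i, CC; split.
- by case: fC => m [_ ->]; rewrite size_map.
- exact/(fill_fill fC l).
- exact/(fill_fill fC r).
Qed.

Lemma der_ctx Z Z' C X X' :
  der Z Z' -> is_fill C Z X -> is_fill C Z' X' -> der X X'.
Proof.
move=> d; elim: d X X' => {Z Z'} [Z Z' j|Z Y Z' zy _ IH] X X' fX fX'.
  apply: der0; apply: fill_uniq fX'.
  exact: fill_riso (riso_refl _) j (riso_refl _) fX.
have [W fW] := fill_ex C Y.
exact: derS (dstep_ctx zy fX fW) (IH _ _ fW fX').
Qed.

Lemma der_graph k X Y : der X Y -> graph k X -> graph k Y.
Proof.
elim=> {X Y} [X Y|X Y Z [i [C [h l r]]] _ IH]; first exact: riso_graph.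
by move/(fill_graph _ l) => gC; apply/IH/(fill_graph _ r) => //; apply: gC.
Qed.

Lemma der_sub L (M : raw L) (Y Y' : rE M -> raw dlabel) X X' :
  rhole M = [::] -> (forall e, graph (size (ratt e)) (Y e)) ->
  (forall e, der (Y e) (Y' e)) -> is_sub Y X -> is_sub Y' X' -> der X X'.
Proof.
move=> ho gY dY sX sX'.
apply: (sub_stepwise (Q := der X) ho _ gY _ _ sX sX').
- by move=> W W' j /der_trans; apply; apply: der0.
- by move=> e; apply: der_graph (dY e) (gY e).
- by move=> e C W W' _ fW fW' /der_trans; apply; apply: der_ctx (dY e) fW fW'.
- exact/der0/riso_refl.
Qed.

(** * Interpretation of types *)

(** A primitive type whose index is the code of no label of its rank has an empty interpretation.
    Hence the condition on placements in the [Div] case can be vacuous, and the rank of [Z] is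
    imposed separately. *)
Fixpoint sem (n : nat) (A : Tp n) : raw dlabel -> Prop :=
  match A with
  | @Prim k i => fun Z => exists x : {k & fib (ranked_sum N S) k},
      [/\ tag x = k, pickle (sval (tagged x)) = i
        & der (rhandle (tag x) (inl x)) Z]
  | @Div m k M D => fun Z => graph k Z /\
      forall (Y : cE D -> raw dlabel) C W, (forall e, sem (clab D e) (Y e)) ->
        is_sub (M := of_ctx D) Y C -> is_fill C Z W -> sem M W
  | @Times k M => fun Z => exists (Y : hE M -> raw dlabel) Z0,
      [/\ forall e, sem (hlab M e) (Y e), is_sub (M := of_hg M) Y Z0 & der Z0 Z]
  end.

Lemma rhandle_graph L k (x : L) : graph k (rhandle k x).
Proof. by split=> //=; rewrite size_enum_ord. Qed.

Lemma sem_graph n (A : Tp n) Z : sem A Z -> graph n Z.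
Proof.
case: A => [k i [x [<- _ d]]|m k M D []|k M [Y [Z0 [_ s d]]]] //.
  exact: der_graph d (rhandle_graph _ _).
exact: der_graph d (sub_graph s (of_hg_graph M)).
Qed.

(** A derivation from [Z] can be carried out inside any context, so in the [Div] case closure is
    inherited from the numerator. *)
Lemma sem_der n (A : Tp n) Z Z' : sem A Z -> der Z Z' -> sem A Z'.
Proof.
elim: A Z Z' => [k i|m k M IH D|k M] Z Z' /=.
- by move=> [x [e1 e2 d]] d'; exists x; split=> //; apply: der_trans d d'.
- move=> [gZ sZ] d; split=> [|Y C W sY sC fW]; first exact: der_graph d gZ.
  have [W0 fW0] := fill_ex C Z.
  exact: IH (sZ Y C W0 sY sC fW0) (der_ctx d fW0 fW).
- by move=> [Y [Z0 [sY s d]]] d'; exists Y, Z0; split=> //; apply: der_trans d d'.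
Qed.

Definition interp (G : raw {k & Tp k}) (X : raw dlabel) : Prop :=
  exists F : rE G -> raw dlabel,
    (forall e, sem (tagged (rlab e)) (F e)) /\ is_sub F X.

Lemma interp_riso G G' X : riso G' G -> interp G X -> interp G' X.
Proof.
case=> j _ [F [sF s]]; exists (F \o iE j); split; last exact: sub_base.
by move=> e; rewrite -(iso_lab j); apply: sF.
Qed.

(** A choice of instances for the hyperedges of a filling is a pair of choices, for the context and
    for its content; [set_colim_dep] pastes such a pair together. *)
Lemma interp_fill C K G X : is_fill C K G ->
  interp G X <-> exists C0 Z, [/\ interp C C0, interp K Z & is_fill C0 Z X].
Proof.
move=> fG; have [pE [qE [lp lq cE fs]]] := fill_sub dlabel fG; split.
  case=> F [sF s].
  have [C0 sC] := sub_ex (F \o pE); have [Z sZ] := sub_ex (F \o qE).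
  exists C0, Z; split; last exact/(fs F C0 Z).
    by exists (F \o pE); split=> // e; rewrite -lp; apply: sF.
  by exists (F \o qE); split=> // e; rewrite -lq; apply: sF.
case=> C0 [Z [[F1 [sF1 s1]] [F2 [sF2 s2]] fX]].
have [F [Fp Fq]] :=
  set_colim_dep (P := fun _ => raw dlabel) F1 (fun _ : unit => F2) cE.
exists F; split.
  apply: (set_colim_ind cE) => [e|[] e]; first by rewrite lp Fp; apply: sF1.
  by rewrite lq (Fq tt); apply: sF2.
apply/(fs F C0 Z) => //.
  by rewrite (_ : F \o pE = F1) //; apply: functional_extensionality => e; apply: Fp.
by rewrite (_ : F \o qE = F2) //; apply: functional_extensionality => e; apply: (Fq tt).
Qed.

Lemma interp_handle n (A : Tp n) X : interp (of_hg (handle A)) X <-> sem A X.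
Proof.
split=> [[F [sF s]]|sA]; last first.
  exists (fun _ => X); split=> //.
  exact: (@sub_handle _ _ n (Tagged Tp A) (fun _ => X) (sem_graph sA)).
have sX := @sub_handle _ _ n (Tagged Tp A) F (sem_graph (sF tt)).
exact: sem_der (sF tt) (der0 (sub_uniq sX s)).
Qed.

Lemma interp_sub L (M : raw L) (F : rE M -> raw {k & Tp k}) G X :
  is_sub F G -> interp G X ->
  exists Y, (forall e, interp (F e) (Y e)) /\ is_sub Y X.
Proof.
move=> sG [H [sH s]]; have [qE [lq cE ss]] := sub_sub dlabel sG.
have /fin_all_exists[Y sY] := fun e => sub_ex (H \o qE e).
exists Y; split=> [e|]; last exact/(ss H Y sY).
by exists (H \o qE e); split=> // y; rewrite -(lq e); apply: sH.
Qed.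

(** For [HL_div_left], the part of [X] at the ÷-hyperedge sits in an instance of [D] whose
    components are good by induction, so the definition of [Div] puts the whole into the numerator.
    [HL_div_right] is the same definition read backwards. For [HL_times_left], the part at the
    ×-hyperedge is only derivable from an instance of [F], and closure under derivation is
    needed. *)
Lemma HL_sound n (G : hg Tp n) (A : Tp n) X :
  HL G A -> interp (of_hg G) X -> sem A X.
Proof.
move=> d; elim: d X => {n G A}.
- move=> n G H A /hiso_riso j _ IH X iX; apply: IH; exact: interp_riso j iX.
- by move=> n A X /interp_handle.
- move=> n m k C M D A F _ IH _ IHF X.
  move/(interp_fill _ (fill_of _ _)) => [C0 [Z [iC iZ fX]]].
  apply: IH; apply/(interp_fill _ (fill_of _ _)); exists C0, Z; split=> //.
  apply/interp_handle.
  move: iZ => /(interp_fill _ (fill_of _ _)) [C1 [Q [iC1 /interp_handle[gQ sQ] fZ]]].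
  have [Y [iY sY]] := interp_sub (ctx_sub_of F) iC1.
  by apply: sQ sY fZ => e; apply: IHF.
- move=> m k M D F _ IH X iX; split.
    by have [H [_ s]] := iX; apply: sub_graph s (of_hg_graph F).
  move=> Y C W sY sC fW; apply: IH.
  by apply/(interp_fill _ (fill_of _ _)); exists C, X; split=> //; exists Y.
- move=> n m C F A _ IH X.
  move/(interp_fill _ (fill_of _ _)) => [C0 [Z [iC /interp_handle sZ fX]]].
  case: sZ => Y [Z0 [sY s d]].
  (* [X0] is an honest instance of the premise, and [X] is derivable from it inside [C0]. *)
  have [X0 fX0] := fill_ex C0 Z0.
  apply: sem_der (der_ctx d fX0 fX); apply: IH.
  by apply/(interp_fill _ (fill_of _ _)); exists C0, Z0; split=> //; exists Y.
- move=> n M F _ IH X iX.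
  have [Y [iY sY]] := interp_sub (sub_of F) iX.
  exists Y, X; split=> // [e|]; first exact: IH.
  exact/der0/riso_refl.
Qed.
End Decorated.

(** * Relabelling and floating hyperedges *)

Definition rmap (L L' : Type) (f : L -> L') (X : raw L) : raw L' :=
  relab (fun e => f (@rlab L X e)).

Lemma fill_rmap (L L' : Type) (f : L -> L') (C K X : raw L) :
  is_fill C K X -> is_fill (rmap f C) (rmap f K) (rmap f X).
Proof.
case=> m [g h].
exists (@Gmap _ (rmap f C) _ (fun _ => rmap f K) (rmap f X)
  (gB m) (@gF _ _ _ _ _ m) (gBE m) (@gFE _ _ _ _ _ m)); split=> //.
case: g => gV gE gaB glB gaF glF ge; split=> //.
  by move=> e; rewrite /= glB.
by move=> i e; rewrite /= glF.
Qed.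

Lemma sub_rmap (L L1 L2 : Type) (f : L1 -> L2) (M : raw L)
    (F : rE M -> raw L1) X :
  is_sub F X -> is_sub (fun e => rmap f (F e)) (rmap f X).
Proof.
case=> m [g h].
exists (@Gmap _ (no_edges L2 M) _ (fun e => rmap f (F e)) (rmap f X)
  (gB m) (@gF _ _ _ _ _ m) (fun e : void => match e with end)
  (@gFE _ _ _ _ _ m)); split=> //.
case: g => gV gE gaB glB gaF glF ge; split=> //.
  case: gE => E S U; split=> // [z|T u w uw].
    by case: (S z) => [[[]]|]; right.
  have [//|v [va vb]] := U T (fun e : void => match e with end) w.
  by exists v; split=> // -[].
by move=> i e; rewrite /= glF.
Qed.

Lemma riso_rmap (L L' : Type) (f : L -> L') (X Y : raw L) :
  riso X Y -> riso (rmap f X) (rmap f Y).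
Proof.
case=> j _; unshelve eexists (@Isom _ (rmap f X) (rmap f Y) (iV j) (iV' j)
  (iE j) (iE' j) (iVK j) (iVK' j) (iEK j) (iEK' j) _ _ _ _) => //= *.
- exact: (iso_att j).
- by rewrite (iso_lab j).
- exact: (iso_ext j).
- exact: (iso_hole j).
Qed.

Definition add0 (L : Type) (Z : raw L) (t : L) : raw L :=
  @Raw L (rV Z) (rE Z + unit)%type
    (fun e => match e with inl e => ratt e | inr _ => [::] end)
    (fun e => match e with inl e => rlab e | inr _ => t end)
    (rext Z) (rhole Z).

Lemma fill_add0 (L : Type) (Z : raw L) (t : L) :
  rhole Z = [::] ->
  exists p : gmap Z (fun _ : unit => rhandle 0 t) (add0 Z t),
    [/\ gluing (fun _ => rhole Z) p,
        rhole (add0 Z t) = map (gF p (i := tt)) (rhole (rhandle 0 t)),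
        gBE p = inl & gFE p (i := tt) = inr].
Proof.
move=> hZ.
have no0 (T : Type) (i : 'I_0) : T by case: i.
exists (@Gmap _ Z _ (fun _ => rhandle 0 t) (add0 Z t) id (fun _ => @no0 _)
  inl (fun _ => inr)); split=> //.
split=> //=.
- split=> [i x []|z|T f h fh] //; first by left; exists z.
  by exists f; split=> // i [].
- split=> // [[z|z]|T f h fh]; [by left; exists z|by right; exists tt, z|].
  exists (fun e => match e with inl x => f x | inr y => h tt y end).
  by split=> // [[]].
- by move=> e; rewrite map_id.
- by move=> i e; apply: esym; apply: size0nil; rewrite size_map size_enum_ord.
- by rewrite map_id.
Qed.

(** * Rule types, the simulation of steps in HL, and the meaning of rule types *)

Section Completeness.
Variables (N S : ranked) (HGr : dpo_grammar N S).
Notation L := (fib (ranked_sum N S)).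
Notation dlab := (dlabel HGr).

(** Terminal and nonterminal labels alike become primitive types. These are numbered separately for
    each rank, so the code of the letter separates labels of equal rank. *)
Definition prim (k : nat) (a : L k) : Tp k := Prim k (pickle (sval a)).

Definition lhs_type (i : rule_ix HGr) : hg Tp (interface (rule i)) :=
  relabel (fun e => prim (hlab (with_ext (phiL (rule i))) e)).

(** The hole is attached to no node. It is the place of the floating hyperedge and makes [rule_type]
    a type of rank 0. *)
Definition rhs_ctx (i : rule_ix HGr) : ctx Tp (interface (rule i)) 0 :=
  Ctx (hatt (rhs (rule i))) (fun e => prim (hlab (rhs (rule i)) e))
    (hext (with_ext (phiR (rule i)))) [tuple].

Definition rule_type (i : rule_ix HGr) : Tp 0 :=
  Div (Times (lhs_type i)) (rhs_ctx i).

Definition type_of (l : dlab) : {k & Tp k} :=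
  match l with
  | inl x => Tagged Tp (prim (tagged x))
  | inr i => Tagged Tp (rule_type i)
  end.

Definition HL_raw (n : nat) (A : Tp n) (X : raw {k & Tp k}) : Prop :=
  exists G : hg Tp n, riso (of_hg G) X /\ HL G A.

Lemma HL_raw_riso n (A : Tp n) X Y : riso X Y -> HL_raw A X -> HL_raw A Y.
Proof. by move=> j [G [GX d]]; exists G; split=> //; apply: riso_trans j. Qed.

Lemma HL_raw_fill n k (A : Tp n) C X (K : hg Tp k) :
  size (rhole C) = k -> is_fill C (of_hg K) X -> HL_raw A X ->
  exists D : ctx Tp n k, riso (of_ctx D) C /\ HL (fill D K) A.
Proof.
move=> hC fX [G [GX d]].
have rC := fill_ranked_ctx fX (riso_ranked GX (@of_hg_ranked _ _ G)).
have sC : size (rext C) = n.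
  by apply/(fill_graph _ fX) => //; apply: riso_graph GX (of_hg_graph G).
have [D jD] := ctx_ex rC sC hC; exists D; split=> //.
apply: HL_iso d; apply/hiso_riso; apply: riso_trans GX _.
apply: fill_uniq fX _.
exact: fill_riso jD (riso_refl _) (riso_refl _) (fill_of D K).
Qed.

Lemma lhs_type_riso i : riso (rmap type_of (lraw i)) (of_hg (lhs_type i)).
Proof.
pose X := rmap type_of (lraw i).
unshelve eexists (@Isom _ X (of_hg (lhs_type i)) id id
  (fun e => match e with inl e => e | inr v => match v with end end)
  inl _ _ _ _ _ _ _ _) => //=; try by case=> [|[]].
- by case=> [e|[]] /=; rewrite ?map_id.
- by rewrite map_id.
Qed.

Lemma rhs_type_riso i :
  riso (add0 (of_ctx (rhs_ctx i)) (Tagged Tp (rule_type i)))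
    (rmap type_of (rraw i)).
Proof.
pose X := add0 (of_ctx (rhs_ctx i)) (Tagged Tp (rule_type i)).
unshelve eexists (@Isom _ X (rmap type_of (rraw i)) id id id id
  _ _ _ _ _ _ _ _) => //=; try by case.
- by move=> e; rewrite map_id.
- by rewrite map_id.
Qed.

(** [HL_times_left] packs the copy of the left-hand side into one hyperedge; [HL_div_left], with
    axioms as minor premises, trades it for the right-hand side and the rule type. The rest
    identifies the hypergraph so obtained: replacing hyperedges by their own handles changes
    nothing, and filling a hole of rank 0 adds a floating hyperedge. *)
Lemma HL_raw_step n (A : Tp n) X Y :
  dstep X Y -> HL_raw A (rmap type_of X) -> HL_raw A (rmap type_of Y).
Proof.
case=> i [C [hC fX fY]] dX.
have fX' := fill_riso (riso_refl _) (lhs_type_riso i) (riso_refl _)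
  (fill_rmap type_of fX).
have [D [jD dD]] := @HL_raw_fill _ _ A (rmap type_of C) _ (lhs_type i) hC fX' dX.
pose F (e : cE (rhs_ctx i)) := handle (clab (rhs_ctx i) e).
have dF e : HL (F e) (clab (rhs_ctx i) e) by apply: HL_ax.
have d := HL_div_left (HL_times_left dD) dF.
exists (fill D (fill (ctx_subst F) (handle (rule_type i)))); split=> //.
have f1 := fill_of D (fill (ctx_subst F) (handle (rule_type i))).
have f2 := fill_of (ctx_subst F) (handle (rule_type i)).
have sR : is_sub (M := of_ctx (rhs_ctx i)) (fun e => of_hg (F e))
    (of_ctx (rhs_ctx i)).
  apply: (@sub_unit _ _ (of_ctx (rhs_ctx i)) (fun e => car (rhs_ctx i) e)
    (fun e => Tagged Tp (clab (rhs_ctx i) e))) => e.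
  by rewrite size_tuple.
have jR := sub_uniq (ctx_sub_of F) sR.
have [p [gp hp _ _]] := @fill_add0 _ (of_ctx (rhs_ctx i)) (Tagged Tp (rule_type i)) erefl.
have f3 : is_fill (of_ctx (rhs_ctx i)) (rhandle 0 (Tagged Tp (rule_type i)))
    (add0 (of_ctx (rhs_ctx i)) (Tagged Tp (rule_type i))) by exists p.
have f2' := fill_riso jR (riso_refl _) (riso_refl _) f2.
have jK := riso_trans (fill_uniq f2' f3) (rhs_type_riso i).
exact: fill_uniq (fill_riso jD jK (riso_refl _) f1) (fill_rmap type_of fY).
Qed.

Lemma HL_raw_der n (A : Tp n) X Y :
  der X Y -> HL_raw A (rmap type_of X) -> HL_raw A (rmap type_of Y).
Proof.
elim=> {X Y} [X Y j|X Y Z xy _ IH].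
  by apply: HL_raw_riso; apply: riso_rmap.
by move/(HL_raw_step xy).
Qed.

Lemma HL_raw_start k (a : L k) :
  HL_raw (prim a) (rmap type_of (rhandle k (inl (Tagged L a)))).
Proof. by exists (handle (prim a)); split; [apply: riso_refl|apply: HL_ax]. Qed.

(** One application of [HL_times_left] per hyperedge. The intermediate hypergraphs, with only some
    hyperedges packed, are known up to isomorphism only, whence the invariant [HL_raw]. *)
Lemma HL_times_all (L' : nat -> Type) n (A : Tp n) (G : hg L' n)
    (M : forall e : hE G, hg Tp (har G e)) X :
  is_sub (M := of_hg G) (fun e => of_hg (M e)) X -> HL_raw A X ->
  HL (relabel (fun e => Times (M e))) A.
Proof.
move=> sX dX.
have sz (e : hE G) : size (@ratt _ (of_hg G) e) = har G e by rewrite size_tuple.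
have sY := @sub_unit _ _ (of_hg G) _ (fun e => Tagged Tp (Times (M e))) sz.
have [G' [j d]] : HL_raw A (of_hg (relabel (fun e => Times (M e)))).
  apply: (sub_stepwise (Q := HL_raw A) _ _ _ _ _ sX sY) => //.
  - exact: HL_raw_riso.
  - by move=> e; rewrite sz; apply: of_hg_graph.
  - by move=> e; rewrite sz; apply: rhandle_graph.
  move=> e C W W'; rewrite sz => hC fW fW' dW.
  have [D [jD dD]] := HL_raw_fill hC fW dW.
  exists (fill D (handle (Times (M e)))); split; last exact: HL_times_left.
  have f := fill_of D (handle (Times (M e))).
  exact: fill_uniq (fill_riso jD (riso_refl _) (riso_refl _) f) fW'.
by apply: HL_iso d; apply/hiso_riso.
Qed.

Lemma fill_trivial (T : Type) k (K : raw T) : graph k K ->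
  is_fill (@Raw T 'I_k void (fun v => match v with end)
    (fun v => match v with end) (ord_tuple k) (ord_tuple k)) K K.
Proof.
case=> sz hK; set C := Raw _ _ _ _.
exists (@Gmap _ C _ (fun _ => K) K (tnth (Tuple (introT eqP sz))) (fun _ => id)
  (fun v : void => match v with end) (fun _ => id)).
split; last by rewrite map_id.
split=> //.
- split=> [i x y /(zrel_ordl sz) ->|z|T' f h fh] //.
    by right; exists tt, z.
  exists (h tt); split=> [x|[] //]; apply/esym/fh; exact/(zrel_ordl sz).
- split=> // [z|T' f h fh]; first by right; exists tt, z.
  by exists (h tt); split=> [[]|[]].
- by move=> i e; rewrite map_id.
- by rewrite [RHS]tnth_enum_map.
Qed.

Lemma lraw_graph (i : rule_ix HGr) : graph (interface (rule i)) (lraw i).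
Proof. by split=> //=; rewrite size_map size_enum_ord. Qed.

Lemma pickle_label_inj (x : {k & L k}) k (a : L k) :
  tag x = k -> pickle (sval (tagged x)) = pickle (sval a) -> x = Tagged L a.
Proof.
case: x => m [b pb] /= mk; case: k / mk a => [[a pa]] /=.
move/(pcan_inj pickleK) => ba; case: a / ba pa => pa.
by rewrite (bool_irrelevance pa pb).
Qed.

Lemma sem_prim k (a : L k) : sem (prim a) (rhandle k (inl (Tagged L a) : dlab)).
Proof. by exists (Tagged L a); split=> //; apply/der0/riso_refl. Qed.

Lemma dstep_rule (i : rule_ix HGr) : dstep (lraw i) (rraw i).
Proof.
exists i; eexists; split; [|exact: fill_trivial (lraw_graph i)|].
- by rewrite /= size_enum_ord.
- by apply: fill_trivial; split=> //=; rewrite size_map size_enum_ord.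
Qed.

(** Each component of the instance of the right-hand side lies in the interpretation of a primitive
    type, so it is derivable from the handle of its label. Carrying out these derivations side by
    side derives [W] from the right-hand side with its tick, which is one decorated step away from
    the left-hand side. *)
Lemma sem_rule i : sem (rule_type i) (rhandle 0 (inr i : dlab)).
Proof.
split; first exact: rhandle_graph.
move=> Y C W sY sC fW.
pose M := add0 (of_ctx (rhs_ctx i)) (Tagged Tp (rule_type i)).
pose F (e : rE M) : raw dlab :=
  match e with inl e => Y e | inr _ => rhandle 0 (inr i) end.
pose f (e : rE M) : dlab := match e with
  | inl e => inl (Tagged L (hlab (rhs (rule i)) e)) | inr _ => inr i end.
pose k (e : rE M) := match e with inl e => har (rhs (rule i)) e | inr _ => 0 end.
have sk (e : rE M) : size (ratt e) = k e by case: e => [e|[]] //=; rewrite size_tuple.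
have sM := sub_unit f sk.
have jM : riso (relab f) (rraw i).
  unshelve eexists (@Isom _ (relab f) (rraw i) id id id id _ _ _ _ _ _ _ _) => //=;
  try by case.
  + by case=> [e|[]] /=; rewrite ?map_id.
  + by rewrite map_id.
have [p [gp hp pB pF]] := @fill_add0 _ (of_ctx (rhs_ctx i)) (Tagged Tp (rule_type i)) erefl.
(* Filling the hole of rank 0 with the tick amounts to replacing all hyperedges of [M], the floating
   one included. *)
have sW : is_sub F W.
  apply/(fill_subP gp hp (F := F) (C0 := C) (Z := rhandle 0 (inr i))) => //.
    by rewrite pB.
  rewrite pF; exact: (@sub_handle _ _ 0 _ (fun _ => rhandle 0 (inr i : dlab))
    (rhandle_graph _ _)).
have dW : der (rraw i) W.
  apply: (der_risol (riso_sym jM)).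
  apply: (der_sub _ _ _ sM sW) => //.
  - by move=> e; rewrite sk; apply: rhandle_graph.
  - case=> [e|[]]; last exact/der0/riso_refl.
    have [x [e1 e2 d]] := sY e.
    suff ex : x = Tagged L (hlab (rhs (rule i)) e).
      by rewrite ex in d.
    exact: pickle_label_inj.
(* The instance of the × type is the left-hand side itself, every hyperedge being replaced by its
   handle. *)
pose g (e : hE (lhs (rule i))) : dlab := inl (Tagged L (hlab (lhs (rule i)) e)).
exists (fun e => rhandle (har (lhs (rule i)) e) (g e)), (relab (Z := of_hg (lhs_type i)) g).
split=> [e||].
- exact: sem_prim.
- by apply: sub_unit => e; rewrite size_tuple.
apply: (@der_risol _ _ _ (lraw i)); last exact: derS (dstep_rule i) dW.
pose X := relab (Z := of_hg (lhs_type i)) g.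
unshelve eexists (@Isom _ X (lraw i) id id inl
  (fun e => match e with inl e => e | inr v => match v with end end)
  _ _ _ _ _ _ _ _) => //=; try by case=> [|[]].
- by move=> e; rewrite map_id.
- by rewrite map_id.
Qed.
End Completeness.

(** * Adding, stripping and distributing ticks *)

Lemma deco_fill (B T : Type) (C K X : raw B) (I J : finType) (f : I -> T)
    (g : J -> T) :
  is_fill C K X ->
  is_fill (deco C f) (deco K g)
    (deco X (fun u : I + J => match u with inl i => f i | inr j => g j end)).
Proof.
case=> m [gm h]; set Y := deco X _.
exists (@Gmap _ (deco C f) _ (fun _ => deco K g) Y (gB m) (@gF _ _ _ _ _ m)
  (fun e => match e with inl e => inl (gBE m e) | inr i => inr (inl i) end)
  (fun u e => match e with inl e => inl (gFE m (i := u) e)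
    | inr j => inr (inr j) end)); split=> //.
case: gm => gV gE gaB glB gaF glF ge; split=> //=.
- case: gE => _ S U; split=> // [[z|[i|j]]|A u v uv].
  + case: (S z) => [[x <-]|[[] [y <-]]]; first by left; exists (inl x).
    by right; exists tt, (inl y).
  + by left; exists (inr i).
  + by right; exists tt, (inr j).
  have [//|w [wB wF]] := U A (u \o inl) (fun i => v i \o inl).
  exists (fun e => match e with inl e => w e | inr (inl i) => u (inr i)
    | inr (inr j) => v tt (inr j) end).
  by split=> [[x|i]|[] [x|j]] //=; rewrite ?wB ?wF.
- by case=> [e|i] //=; rewrite gaB.
- by case=> [e|i] //=; rewrite glB.
- by move=> i [e|j] //=; rewrite gaF.
- by move=> i [e|j] //=; rewrite glF.
Qed.

Lemma deco_riso (B T : Type) (X Y : raw B) (K K' : finType) (f : K -> T)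
    (f' : K' -> T) (phi : K -> K') (psi : K' -> K) :
  riso X Y -> cancel phi psi -> cancel psi phi ->
  (forall k, f' (phi k) = f k) -> riso (deco X f) (deco Y f').
Proof.
case=> j _ c1 c2 ff.
unshelve eexists (@Isom _ (deco X f) (deco Y f') (iV j) (iV' j)
  (fun e => match e with inl e => inl (iE j e) | inr k => inr (phi k) end)
  (fun e => match e with inl e => inl (iE' j e) | inr k => inr (psi k) end)
  (iVK j) (iVK' j) _ _ _ _ _ _) => //=.
- by case=> x /=; rewrite ?iEK ?c1.
- by case=> x /=; rewrite ?iEK' ?c2.
- by case=> x //=; rewrite ?(iso_att j).
- by case=> x //=; rewrite ?(iso_lab j) ?ff.
- exact: (iso_ext j).
- exact: (iso_hole j).
Qed.

(** Labels lie in a sum, so an isomorphism maps ticks to ticks and other hyperedges to other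
    hyperedges. The equality of cardinals is what later counts steps. *)
Lemma deco_riso_inv (B T : Type) (X Y : raw B) (K K' : finType) (f : K -> T)
    (f' : K' -> T) :
  riso (deco X f) (deco Y f') -> riso X Y /\ #|K| = #|K'|.
Proof.
case=> j _.
have /fin_all_exists[u uP] : forall e, exists e', iE j (inl e) = inl e'.
  by move=> e; have := iso_lab j (inl e); case: (iE j _) => // e' _; exists e'.
have /fin_all_exists[u' uP'] : forall e, exists e', iE' j (inl e) = inl e'.
  move=> e; have := iso_lab (isom_sym j) (inl e) => /=.
  by case: (iE' j _) => // e' _; exists e'.
have /fin_all_exists[v vP] : forall k, exists k', iE j (inr k) = inr k'.
  by move=> k; have := iso_lab j (inr k); case: (iE j _) => // k' _; exists k'.
have /fin_all_exists[v' vP'] : forall k, exists k', iE' j (inr k) = inr k'.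
  move=> k; have := iso_lab (isom_sym j) (inr k) => /=.
  by case: (iE' j _) => // k' _; exists k'.
have inl_inj (E F : Type) : injective (@inl E F) by move=> x y [].
have inr_inj (E F : Type) : injective (@inr E F) by move=> x y [].
split; last first.
  apply: (bij_eq_card (f := v)); exists v' => k.
    by apply: (inr_inj (rE X)); rewrite -vP' -vP iEK.
  by apply: (inr_inj (rE Y)); rewrite -vP -vP' iEK'.
unshelve eexists (@Isom _ X Y (iV j) (iV' j) u u' (iVK j) (iVK' j)
  _ _ _ _ (iso_ext j) (iso_hole j)) => // e.
- by apply: (inl_inj _ K); rewrite -uP' -uP iEK.
- by apply: (inl_inj _ K'); rewrite -uP -uP' iEK'.
- by have := iso_att j (inl e); rewrite uP.
- by have := iso_lab j (inl e); rewrite uP => -[].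
Qed.

Lemma deco_split (B T : Type) (b0 : B) (t0 : T) (Z : raw (B + T)) :
  (forall e, ~~ is_inl (rlab e) -> @ratt _ Z e = [::]) ->
  exists (X : raw B) (K : finType) (f : K -> T),
    [/\ riso Z (deco X f), size (rhole X) = size (rhole Z)
      & size (rext X) = size (rext Z)].
Proof.
move=> Z0.
pose E : finType := {e : rE Z | is_inl (rlab e)}.
pose K : finType := {e : rE Z | ~~ is_inl (rlab e)}.
(* The defaults [b0] here and [t0] in [f] sit in branches excluded by membership in [E] and [K]. *)
pose X := @Raw B (rV Z) E (fun e => ratt (val e))
  (fun e => match rlab (val e) with inl b => b | inr _ => b0 end)
  (rext Z) (rhole Z).
pose f (k : K) := match rlab (val k) with inl _ => t0 | inr t => t end.
exists X, K, f; split=> //; apply: riso_sym.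
pose psi (e : (E + K)%type) : rE Z := match e with inl e => val e | inr e => val e end.
have phiP e : {u | psi u = e}.
  have [h|h] := boolP (is_inl (rlab e)).
    by exists (inl (exist _ e h)).
  by exists (inr (exist _ e h)).
pose phi e := sval (phiP e).
have c1 : cancel phi psi by move=> e; apply: (svalP (phiP e)).
have pi : injective psi.
  move=> [[x hx]|[x hx]] [[y hy]|[y hy]] /= xy.
  - by congr inl; apply: val_inj.
  - by exfalso; move: hx; rewrite xy (negbTE hy).
  - by exfalso; move: hx; rewrite xy hy.
  - by congr inr; apply: val_inj.
have c2 : cancel psi phi by move=> e; apply: pi; rewrite c1.
unshelve eexists (@Isom _ (deco X f) Z id id psi phi _ _ c2 c1 _ _ _ _) => //=.
- by case=> [e|[e he]] /=; [rewrite map_id | exact: Z0].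
- case=> e /=; rewrite /f; first by have := valP e; case: (rlab _).
  by have := valP e; case: (rlab _).
- by rewrite map_id.
- by rewrite map_id.
Qed.

Lemma sub_deco (L0 B T : Type) (Z : raw L0) (k : rE Z -> nat) (f : rE Z -> B)
    (K : rE Z -> finType) (g : forall e, K e -> T) :
  (forall e, size (ratt e) = k e) ->
  is_sub (fun e => deco (rhandle (k e) (f e)) (g e))
    (deco (relab f) (fun u : {e & K e} => g (tag u) (tagged u))).
Proof.
move=> sz; set F := fun e => _; set Y := deco _ _.
exists (@Gmap _ (no_edges _ Z) _ F Y id
  (fun e => tnth (Tuple (introT eqP (sz e)))) (fun v : void => match v with end)
  (fun e x => match x with inl _ => inl e
     | inr y => inr (Tagged (fun e => K e) y) end)); split; last by rewrite map_id.
split=> //.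
- split=> [e u v /(zrel_ordr (sz e))|z|A u h uh] //; first by left; exists z.
  by exists u; split=> // e y; apply/uh/(zrel_ordr (sz e)).
- split=> // [[z|[e y]]|A u h uh]; first by right; exists z, (inl tt).
    by right; exists e, (inr y).
  exists (fun e => match e with inl e => h e (inl tt)
    | inr y => h (tag y) (inr (tagged y)) end).
  by split=> // e [[]|y].
- by move=> e [[]|y] //=; rewrite [RHS]tnth_enum_map.
- by move=> e [[]|y].
- by rewrite map_id.
Qed.

(** [K] injects into pairs of a hyperedge and a slot below [c]. The elements sent to [e] become the
    ticks of [e]; their slots are distinct, so there are at most [c] of them, which is why their
    number lives in ['I_c.+1]. *)
Lemma distribute (K E T : finType) (c : nat) (f : K -> T) :
  #|K| <= c * #|E| ->
  exists (w : E -> {m : 'I_c.+1 & {ffun 'I_m -> T}})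
      (phi : K -> {e & 'I_(tag (w e))}) (psi : {e & 'I_(tag (w e))} -> K),
    [/\ cancel phi psi, cancel psi phi
      & forall k, tagged (w (tag (phi k))) (tagged (phi k)) = f k].
Proof.
move=> leK.
have le : #|K| <= #|{: E * 'I_c}| by rewrite card_prod card_ord mulnC.
pose j k : E * 'I_c := enum_val (widen_ord le (enum_rank k)).
have j_inj : injective j.
  by move=> x y /enum_val_inj/(congr1 val)/= xy; apply/enum_rank_inj/val_inj.
pose A e := [pred k | (j k).1 == e].
have Ac e : #|A e| < c.+1.
  rewrite ltnS -[X in _ <= X]card_ord.
  apply: (leq_card_in (fun k => (j k).2)) => x y /eqP x1 /eqP y1 xy.
  by apply: j_inj; rewrite [LHS]surjective_pairing [RHS]surjective_pairing x1 y1 xy.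
pose w e : {m : 'I_c.+1 & {ffun 'I_m -> T}} :=
  existT (fun m : 'I_c.+1 => {ffun 'I_m -> T}) (Ordinal (Ac e))
    [ffun i : 'I_#|A e| => f (enum_val i)].
have kA k : k \in A (j k).1 by rewrite inE.
pose phi k : {e & 'I_(tag (w e))} :=
  existT (fun e => 'I_(tag (w e))) (j k).1 (enum_rank_in (kA k) k).
pose psi (u : {e & 'I_(tag (w e))}) : K :=
  enum_val (A := A (tag u)) (tagged u).
have c1 : cancel phi psi by move=> k; rewrite /psi /phi /= enum_rankK_in ?kA.
have psi_inj : injective psi.
  move=> [e i] [e' i']; rewrite /psi /= => ii.
  have /eqP ei : enum_val (A := A e) i \in A e by apply: enum_valP.
  have /eqP ei' : enum_val (A := A e') i' \in A e' by apply: enum_valP.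
  have ee : e = e' by rewrite -ei -ei' ii.
  by case: e' / ee i' ii {ei'} => i' /enum_val_inj ->.
exists w, phi, psi; split=> // [u|k]; first by apply: psi_inj; rewrite c1.
by rewrite /= ffunE enum_rankK_in ?kA.
Qed.

(** * The grammar and its language *)

Section Final.
Variables (N S : ranked) (HGr : dpo_grammar N S).
Notation L := (fib (ranked_sum N S)).
Notation dlab := (dlabel HGr).

Lemma riso_deco_void (B T : Type) (X : raw B) (K : finType) (f : K -> T)
    (g : K + void -> T) : (forall k, g (inl k) = f k) ->
  riso (deco X g) (deco X f).
Proof.
move=> gf.
apply: (@deco_riso _ _ _ _ (K + void)%type K g f (fun u =>
  match u with inl k => k | inr v => match v with end end) inl (riso_refl X)).
- by case=> [k|[]].
- by [].
- by case=> [k|[]] //=; rewrite gf.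
Qed.

(** The ticks present at the start are arbitrary for the sake of the induction; each step enlarges
    their index type by one point. *)
Lemma steps_der t n (G H : hg L n) (K : finType) (f : K -> rule_ix HGr) :
  dpo_steps HGr t G H ->
  exists (K' : finType) (f' : K' -> rule_ix HGr),
    #|K'| = #|K| + t /\ der (deco (of_hg G) f) (deco (of_hg H) f').
Proof.
elim: t G K f => [|t IH] G K f /=.
  move=> /hiso_riso j; exists K, f; rewrite addn0; split=> //.
  exact/der0/(deco_riso j (phi := id) (psi := id)).
case=> G' [[r [rin /dpo_applyP[C [hC fG fG']]]] st].
have [i ir] := In_lookup rin.
rewrite -[r]ir -/(rule i) in hC fG fG'.
have [K' [f' [cK d]]] := IH G' (K + unit)%type
  (fun u => match u with inl k => f k | inr _ => i end) st.
exists K', f'; split; first by rewrite cK card_sum card_unit addn1 addnS.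
apply: derS d; exists i, (deco C f); split=> //.
  apply: (fill_riso (riso_refl _) (riso_refl _) _ (deco_fill f _ fG)).
  exact: riso_deco_void.
exact: deco_fill.
Qed.

Lemma dpo_steps_hiso t n (G H H' : hg L n) :
  dpo_steps HGr t G H -> hiso H H' -> dpo_steps HGr t G H'.
Proof.
elim: t G => [|t IH] G /=.
  by move=> /hiso_riso j /hiso_riso j'; apply/hiso_riso; apply: riso_trans j j'.
by case=> G' [s st] j; exists G'; split=> //; apply: IH st j.
Qed.

(** Gluings and isomorphisms preserve labels and the lengths of attachments. A tick of the context
    thus ends up as a tick of [deco X f], which is attached to nothing. *)
Lemma fill_deco_inv (C Y : raw dlab) K (J : finType) (g : J -> rule_ix HGr) X
    (I : finType) (f : I -> rule_ix HGr) :
  is_fill C (deco K g) Y -> riso Y (deco X f) ->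
  forall e, ~~ is_inl (rlab e) -> @ratt _ C e = [::].
Proof.
case=> m [gm _] [j _] e ne.
have := iso_att j (gBE m e); have := iso_lab j (gBE m e).
rewrite (gl_labB gm) (gl_attB gm) -map_comp.
case: (iE j _) => [e'|k'] /=; first by move=> le; rewrite -le in ne.
by move=> _ /esym/(congr1 size); rewrite size_map => /size0nil.
Qed.

(** No left-hand side contains a tick, so the ticks of the current hypergraph all lie in the context
    of a step. Removing them there leaves a step of the grammar, and the tick created on the right
    accounts for it in the count. *)
Lemma der_steps n (G : hg L n) (K : finType) (f : K -> rule_ix HGr) X Z :
  der X Z -> riso X (deco (of_hg G) f) ->
  exists (H : hg L n) (K' : finType) (f' : K' -> rule_ix HGr) t,
    [/\ dpo_steps HGr t G H, #|K'| = #|K| + t & riso Z (deco (of_hg H) f')].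
Proof.
move=> d; elim: d G K f => {X Z} [X Z j|X Y Z [i [C [hC fX fY]]] _ IH] G K f jX.
  exists G, K, f, 0; split; [|by rewrite addn0|].
    exact/hiso_riso/riso_refl.
  exact: riso_trans (riso_sym j) jX.
have C0 := fill_deco_inv fX jX.
(* The start label and the rule [i] serve only as the defaults that [deco_split] asks for. *)
have [C1 [K1 [f1 [jC hC1 eC1]]]] := @deco_split _ _
  (Tagged L (exist (fun x : ranked_sum N S => rk x == _) (inl (dpo_start HGr)) (eqxx _)))
  i C C0.
have [X1 fX1] := fill_ex C1 (of_hg (with_ext (phiL (rule i)))).
have [Y1 fY1] := fill_ex C1 (of_hg (with_ext (phiR (rule i)))).
have dX := deco_fill f1 (fun v : void => match v with end) fX1.
have dY := deco_fill f1 (fun _ : unit => i) fY1.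
have jX1 := fill_uniq (fill_riso jC (riso_refl _) (riso_refl _) fX) dX.
have jY1 := fill_uniq (fill_riso jC (riso_refl _) (riso_refl _) fY) dY.
have [jG cK] := deco_riso_inv (riso_trans (riso_sym jX1) jX).
have fG := fill_riso (riso_refl _) (riso_refl _) jG fX1.
(* The stripped context is part of [G] and hence well ranked; so is the result of the step, which
   therefore comes from a typed hypergraph. *)
have rC := fill_ranked_ctx fG (@of_hg_ranked _ _ G).
have rY := fill_ranked fY1 rC (@of_hg_ranked _ _ _).
have gY : graph n Y1.
  apply/(fill_graph _ fY1) => //; apply/(fill_graph _ fG) => //.
  exact: of_hg_graph.
have [G' jG'] := hg_ex rY gY.
have jY : riso Y (deco (of_hg G') (fun u : K1 + unit =>
    match u with inl k => f1 k | inr _ => i end)).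
  apply: riso_trans jY1 _.
  exact: (deco_riso (riso_sym jG') (phi := id) (psi := id)).
have [H [K' [f' [t [st cK' jZ]]]]] := IH G' _ _ jY.
exists H, K', f', t.+1; split=> //; last first.
  by rewrite cK' -cK !card_sum card_unit card_void addn0 addn1 addnS.
exists G'; split=> //; exists (rule i); split; first exact: lookup_In.
apply/dpo_applyP; exists C1; split=> //; first by rewrite hC1.
exact: fill_riso (riso_refl _) (riso_refl _) (riso_sym jG') fY1.
Qed.

(** Words of at most [c] rules, packaged as a finite type so that enumerating it gives the finitely
    many types of a letter. *)
Definition ticks (c : nat) : finType :=
  {m : 'I_c.+1 & {ffun 'I_m -> rule_ix HGr}}.

Definition letter_hg (c k : nat) (a : L k) (w : ticks c) : hg Tp k :=
  @Hg Tp k 'I_k (unit + 'I_(tag w))%type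
    (fun u => match u with inl _ => k | inr _ => 0 end)
    (fun u => match u return (match u with inl _ => k | inr _ => 0 end).-tuple 'I_k
      with inl _ => ord_tuple k | inr _ => [tuple] end)
    (fun u => match u return Tp (match u with inl _ => k | inr _ => 0 end)
      with inl _ => prim a | inr i => rule_type (tagged w i) end)
    (ord_tuple k).

Definition letter_raw (c k : nat) (a : L k) (w : ticks c) : raw dlab :=
  deco (rhandle k (Tagged L a)) (tagged w).

Lemma letter_hg_riso c k (a : L k) (w : ticks c) :
  riso (rmap (@type_of _ _ HGr) (letter_raw a w)) (of_hg (letter_hg a w)).
Proof.
set X := rmap _ _.
unshelve eexists (@Isom _ X (of_hg (letter_hg a w)) id id id id
  _ _ _ _ _ _ _ _) => //=; rewrite ?map_id //.
- by case=> [[]|j] //=; rewrite map_id.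
- by case=> [[]|j].
Qed.

Lemma sem_letter c k (a : L k) (w : ticks c) :
  sem (Times (letter_hg a w)) (letter_raw a w).
Proof.
pose f (u : unit + 'I_(tag w)) : dlab :=
  match u with inl _ => inl (Tagged L a) | inr i => inr (tagged w i) end.
pose r (u : unit + 'I_(tag w)) := match u with inl _ => k | inr _ => 0 end.
exists (fun u => rhandle (r u) (f u)), (relab (Z := of_hg (letter_hg a w)) f).
split.
- by case=> [u|i]; [apply: sem_prim|apply: sem_rule].
- by apply: sub_unit => u; rewrite size_tuple.
apply/der0; set X := relab _.
unshelve eexists (@Isom _ X (letter_raw a w) id id id id
  _ _ _ _ _ _ _ _) => //=; rewrite ?map_id //.
- by case=> [[]|j] //=; rewrite map_id.
Qed.

Definition start_label : L (start_rank HGr) :=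
  exist (fun x : ranked_sum N S => rk x == start_rank HGr)
    (inl (dpo_start HGr)) (eqxx (start_rank HGr)).

Definition hl_of_dpo (c : nat) : hl_grammar S (start_rank HGr) :=
  @HlGrammar S (start_rank HGr)
    (fun k a => [seq Times (letter_hg (@term_label N S k a) w)
                | w <- enum (ticks c)])
    (prim start_label).

Lemma In_map (T : eqType) (U : Type) (f : T -> U) (s : seq T) y :
  List.In y (map f s) <-> exists2 x, x \in s & y = f x.
Proof.
elim: s => [|x s IH] /=; first by split=> // [[]].
split=> [[<-|/IH[z zs ->]]|[z]].
- by exists x; rewrite ?mem_head.
- by exists z; rewrite // in_cons zs orbT.
by rewrite in_cons => /orP[/eqP-> ->|zs yz]; [left|right; apply/IH; exists z].
Qed.

Lemma of_start : riso
  (rhandle (start_rank HGr) (inl (Tagged L start_label)) : raw dlab)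
  (deco (of_hg (start_hg HGr)) (fun v : void => match v with end)).
Proof.
set X := rhandle _ _; set Y := deco _ _.
unshelve eexists (@Isom _ X Y id id inl
  (fun e => match e with inl e => e | inr v => match v with end end)
  _ _ _ _ _ _ _ _) => //=; rewrite ?map_id //.
- by case=> [|[]].
Qed.

Section Word.
Variables (c : nat) (H : hg (fib S) (start_rank HGr)) (w : hE H -> ticks c).

Definition word_raw : raw dlab :=
  deco (of_hg (term_hg N H))
    (fun u : {e : hE H & 'I_(tag (w e))} => tagged (w (tag u)) (tagged u)).

Lemma sub_word :
  is_sub (M := of_hg H)
    (fun e => letter_raw (term_label N (hlab H e)) (w e)) word_raw.
Proof.
apply: (@sub_deco _ _ _ (of_hg H) (fun e => har H e)
  (fun e => Tagged L (term_label N (hlab H e))) (fun e => 'I_(tag (w e)))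
  (fun e => tagged (w e))) => e.
by rewrite size_tuple.
Qed.
End Word.

(** Choosing for each hyperedge its letter with the ticks of its type gives an instance of the
    sequent. By soundness this decorated [H] is derivable from the start handle, and stripping it
    gives a derivation with as many steps as there are ticks. *)
Lemma generates_sound c H :
  hl_generates (hl_of_dpo c) H -> dpo_language_bounded HGr c H.
Proof.
case=> f [fin d].
have /fin_all_exists[w fw] : forall e, exists w : ticks c,
    f e = Times (letter_hg (term_label N (hlab H e)) w).
  by move=> e; have /In_map[w _ ->] := fin e; exists w.
have [x [xk xp dx]] : sem (prim start_label) (word_raw w).
  apply: HL_sound d _; exists (fun e => letter_raw (term_label N (hlab H e)) (w e)).
  split=> [e|]; last exact: sub_word.
  by rewrite [rlab _]/= [tagged _]/= fw; apply: sem_letter.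
rewrite (pickle_label_inj xk xp) in dx.
have [H' [K' [f' [t [st cK jH]]]]] := der_steps dx of_start.
have [jH' cK'] := deco_riso_inv jH.
have {}st : dpo_derives HGr t H.
  by apply: dpo_steps_hiso st _; apply/hiso_riso; apply: riso_sym.
split; first by exists t.
(* The start handle carries no tick, so [t] is exactly the number of ticks of [H]; each hyperedge
   holds at most [c]. *)
exists t => //; move: cK; rewrite card_void add0n -cK' => <-.
have -> : c * #|hE H| = #|{: hE H * 'I_c}| by rewrite card_prod card_ord mulnC.
have le e : tag (w e) <= c by rewrite -ltnS ltn_ord.
apply: (leq_card (fun u : {e : hE H & 'I_(tag (w e))} =>
  (tag u, widen_ord (le (tag u)) (tagged u)))) => -[e i] [e' i'] /= [ee].
case: e' / ee i' => i' ii; congr existT; exact: val_inj.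
Qed.

(** The decorated derivation ends with exactly [t] ticks, few enough to be dealt out to the
    hyperedges of [H]. Simulating it from the axiom for the start symbol leaves every letter next to
    its rule types, and these groups are then packed into × types. *)
Lemma generates_complete c H :
  dpo_language_bounded HGr c H -> hl_generates (hl_of_dpo c) H.
Proof.
case=> _ [t tc st].
have [K [f [cK dH]]] := steps_der (fun v : void => match v with end) st.
have [|w [phi [psi [c1 c2 lab]]]] := @distribute K (hE H) (rule_ix HGr) c f.
  by rewrite cK card_void.
have jH : riso (deco (of_hg (term_hg N H)) f) (word_raw w).
  exact: deco_riso (riso_refl _) c1 c2 lab.
have dW := der_trans (der_risol of_start dH) (der0 jH).
have hW := HL_raw_der dW (HL_raw_start HGr start_label).
exists (fun e => Times (letter_hg (term_label N (hlab H e)) (w e))); split.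
  by move=> e; apply/In_map; exists (w e); rewrite ?mem_enum.
apply: HL_times_all hW.
apply: sub_riso (sub_rmap (@type_of _ _ HGr) (sub_word w)) => [e|].
  exact: letter_hg_riso.
exact: riso_refl.
Qed.
End Final.

Theorem theorem3 (N S : ranked) (HGr : dpo_grammar N S) (c : nat) :
  exists Gr : hl_grammar S (start_rank HGr),
    forall H : hg (fib S) (start_rank HGr),
      hl_generates Gr H <-> dpo_language_bounded HGr c H.
Proof.
exists (hl_of_dpo HGr c) => H.
by split; [apply: generates_sound|apply: generates_complete].
Qed.
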